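(* Let $f:\mathcal X\to[0,1]$, $\mathcal X\subset[0,1]$, be a topologically transitive, piecewise expanding Markov map with repeller $\Lambda$, and let $\mu$ be an ergodic $f$-invariant probability measure supported on $\Lambda$. If $\overline{\dim}_M(\mu)<\infty$, then for $\mu$-a.e. $x\in\Lambda$, $$\limsup_{r\to0}\frac{\log \tau_r(x)}{-\log r}\ge\overline{\dim}_M(\mu),\qquad \liminf_{r\to0}\frac{\log \tau_r(x)}{-\log r}\ge\underline{\dim}_M(\mu).$$ If moreover $(f,\mu)$ is exponentially $\psi$-mixing, then for $\mu$-a.e. $x\in\Lambda$, $$\limsup_{r\to0}\frac{\log \tau_r(x)}{-\log r}=\overline{\dim}_M(\mu),\qquad \liminf_{r\to0}\frac{\log \tau_r(x)}{-\log r}=\underline{\dim}_M(\mu).$$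
   Context: Setting. Let $\mathcal A$ be a finite or countable index set and $\mathcal P=\{P_a\}_{a\in\mathcal A}$ a collection of subintervals of $[0,1]$ with disjoint interiors covering $\mathcal X\subset[0,1]$. A map $f:\mathcal X\to[0,1]$ is a piecewise expanding Markov map if (1) for every $a\in\mathcal A$, $f_a:=f|_{P_a}$ is continuous, injective, and $f(P_a)$ is a union of elements of $\mathcal P$; (2) there is a uniform constant $\gamma>1$ with $|Df_a|\ge\gamma$ for all $a\in\mathcal A$. The repeller is $\Lambda:=\{x\in\mathcal X: f^k(x)\in\bigcup_{a\in\mathcal A}P_a \text{ for all } k\ge0\}$. Let $M$ be the $\mathcal A\times\mathcal A$ matrix with $M_{ab}=1$ if $f(P_a)\cap P_b\ne\emptyset$ and $M_{ab}=0$ otherwise; $f$ is topologically transitive if for all $a,b\in\mathcal A$ there is $k$ with $(M^k)_{ab}>0$. Symbolic coding. $\Sigma:=\{(x_0,x_1,\dots)\in\mathcal A^{\mathbb N_0}: M_{x_k,x_{k+1}}=1\ \forall k\ge0\}$ with left shift $\sigma$; the projection $\pi:\Sigma\to\Lambda$ is given by $x=\pi(x_0,x_1,\dots)$ iff $x\in\bigcap_{i\ge0}f^{-i}P_{x_i}$, so $f\circ\pi=\pi\circ\sigma$. The symbolic measure $\tilde\mu$ corresponding to $\mu$ satisfies $\mu=\pi_*\tilde\mu$. $\Sigma_n$ is the set of admissible words of length $n$, $\Sigma^*=\bigcup_{l\ge1}\Sigma_l$, and for $\mathbf i=(i_0,\dots,i_{n-1})\in\Sigma_n$, $[\mathbf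 i]:=\{y\in\Sigma: y_j=i_j,\ 0\le j\le n-1\}$. Exponential $\psi$-mixing. $(f,\mu)$ is exponentially $\psi$-mixing if there are $C_1,\rho>0$ and a monotone decreasing function $\psi$ with $\psi(k)\le C_1e^{-\rho k}$ for all $k\in\mathbb N$ such that for all $n,k\in\mathbb N$, $\mathbf i\in\Sigma_n$, $\mathbf j\in\Sigma^*$, $$\left|\frac{\tilde\mu([\mathbf i]\cap\sigma^{-(n+k)}[\mathbf j])}{\tilde\mu[\mathbf i]\,\tilde\mu[\mathbf j]}-1\right|\le\psi(k).$$ Cover time. For $x\in\Lambda$ and $r>0$, $\tau_r(x):=\inf\{k:\ \forall y\in\Lambda\ \exists\, j\le k \text{ with } d(f^j(x),y)<r\}$ (here $j,k$ are non-negative integers and $d(x,y)=|x-y|$). Minkowski dimensions. $M_\mu(r):=\min_{x\in\mathrm{supp}(\mu)}\mu(B(x,r))$, $\overline{\dim}_M(\mu):=\limsup_{r\to0}\frac{\log M_\mu(r)}{\log r}$, $\underline{\dim}_M(\mu):=\liminf_{r\to0}\frac{\log M_\mu(r)}{\log r}$. *)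

(* Defs.v *)
From HB Require Import structures.
From mathcomp Require Import all_boot all_order all_algebra.
From mathcomp Require Import all_classical all_reals all_analysis.

Set Implicit Arguments.
Unset Strict Implicit.
Unset Printing Implicit Defensive.

Import Order.TTheory GRing.Theory Num.Theory numFieldNormedType.Exports.
Local Open Scope classical_set_scope.
Local Open Scope ring_scope.

(* A map X -> [0, 1] is a total function R -> R, of which only the values on X
   matter; preimages are intersected with X accordingly. *)
Section markov_map.
Context {R : realType} {A : Type}.
Implicit Types (P : A -> set R) (X : set R) (f : R -> R).

(* The derivative of f_a is that of f restricted to P a, hence one-sided at an
   endpoint that belongs to P a; the intervals are nondegenerate so that it is
   meaningful. *)
Definition expanding P f :=
  exists2 gamma : R, 1 < gamma &
    forall a x, P a x -> exists2 l : R,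
      (f y - f x) / (y - x) @[y --> within (P a) x^'] --> l & gamma <= `|l|.

Definition interval_partition P X :=
  [/\ forall a, [/\ is_interval (P a), P a `<=` `[0, 1] & interior (P a) !=set0],
      trivIset [set: A] (fun a => interior (P a)) &
      X = \bigcup_a P a].

Definition markov P f :=
  forall a, [/\ {within P a, continuous f},
                {in P a &, injective f} &
                exists B : set A, f @` P a = \bigcup_(b in B) P b].

Definition piecewise_expanding_markov P X f :=
  [/\ interval_partition P X, f @` X `<=` `[0, 1], markov P f & expanding P f].

Definition repeller P X f : set R :=
  [set x | X x /\ forall k, (\bigcup_a P a) (iter k f x)].

Definition transition_matrix P f (a b : A) : \bar R :=
  if `[< f @` P a `&` P b !=set0 >] then 1%E else 0%E.

End markov_map.

Section transitivity.
Context {R : realType} {A : choiceType}.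

(* Entries of powers of an infinite nonnegative matrix may be infinite. *)
Fixpoint matrix_power (M : A -> A -> \bar R) (k : nat) (a b : A) : \bar R :=
  if k is k'.+1 then (\esum_(c in [set: A]) (M a c * matrix_power M k' c b))%E
  else if a == b then 1%E else 0%E.

Definition topologically_transitive (P : A -> set R) (f : R -> R) :=
  forall a b, exists2 k, (0 < k)%N &
    (0 < matrix_power (transition_matrix P f) k a b)%E.

End transitivity.

Section invariant_measure.
Context {R : realType} (X : set R) (f : R -> R)
  (mu : probability (measurableTypeR R) R).

Definition invariant_measure :=
  forall B : set (measurableTypeR R), measurable B ->
    mu (X `&` f @^-1` B) = mu B.

Definition ergodic_measure :=
  forall B : set (measurableTypeR R), measurable B ->
    X `&` f @^-1` B = B -> mu B = 0%E \/ mu B = 1%E.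

End invariant_measure.

(* A^N with the sigma-algebra generated by its coordinates, i.e. the Borel
   sigma-algebra of the product topology when A is countable and discrete. *)
Definition coordinate_sets (A : Type) : set (set (nat -> A)) :=
  [set C | exists n a, C = [set w | w n = a]].

Definition sequences (A : pointedType) :=
  g_sigma_algebraType (@coordinate_sets A).

Section symbolic_coding.
Context {R : realType} {A : pointedType}.
Variables (P : A -> set R) (f : R -> R).
Let M := transition_matrix P f.

Definition shift_space : set (nat -> A) :=
  [set w | forall k, M (w k) (w k.+1) = 1%E].

Definition shift (w : nat -> A) : nat -> A := fun k => w k.+1.

Definition coded_points (w : nat -> A) : set R :=
  \bigcap_i (iter i f @^-1` P (w i)).

(* coded_points w has at most one element by expansion, but it can be empty
   for some admissible w (for instance when the intervals are half-open); the
   value 0 is then irrelevant, see symbolic_measure. *)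
Definition coding_map (w : nat -> A) : R := xget 0 (coded_points w).

Definition admissible_word (i : seq A) : bool :=
  (i != [::]) && sorted (fun a b => M a b == 1%E) i.

Definition cylinder (i : seq A) : set (sequences A) :=
  [set y | shift_space y /\ mkseq y (size i) = i].

Definition symbolic_measure (mu : probability (measurableTypeR R) R)
    (mut : probability (sequences A) R) :=
  {ae mut, forall w, shift_space w /\ coded_points w (coding_map w)} /\
  forall B : set (measurableTypeR R), measurable B ->
    pushforward mut coding_map B = mu B.

(* Since psi tends to 0 and x / 0 = 0, the inequality forces every admissible
   cylinder to have positive measure, so that the quotient is genuine. *)
Definition exponentially_psi_mixing
    (mu : probability (measurableTypeR R) R) :=
  exists2 mut : probability (sequences A) R, symbolic_measure mu mut &
  exists (C1 rho : R) (psi : nat -> R),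
    [/\ 0 < C1, 0 < rho,
        forall k l, (0 < k <= l)%N -> psi l <= psi k,
        forall k, (0 < k)%N -> psi k <= C1 * expR (- rho * k%:R) &
        forall (i j : seq A) (k : nat),
          admissible_word i -> admissible_word j -> (0 < k)%N ->
          `| fine (mut (cylinder i `&`
                        iter (size i + k) shift @^-1` cylinder j)) /
             (fine (mut (cylinder i)) * fine (mut (cylinder j))) - 1 |
          <= psi k].

End symbolic_coding.

(* The infimum of an empty set is +oo: tau_r(x) = +oo if the r-dense orbit
   segment does not exist. *)
Definition cover_time {R : realType} (L : set R) (f : R -> R) (r x : R) :
    \bar R :=
  ereal_inf [set k%:R%:E | k in [set k : nat |
    forall y, L y -> exists2 j, (j <= k)%N & `|iter j f x - y| < r]].

Section minkowski_dimension.
Context {R : realType} (mu : probability (measurableTypeR R) R).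

Definition measure_support : set R :=
  [set x | forall U : set R, open U -> U x -> (0 < mu U)%E].

(* The infimum is attained: the support is compact when mu lives on [0, 1], and
   x |-> mu (ball x r) is lower semicontinuous. *)
Definition min_ball_measure (r : R) : \bar R :=
  ereal_inf [set mu (ball x r) | x in measure_support].

Definition upper_minkowski_dim : \bar R :=
  limf_esup (fun r : R => lne (min_ball_measure r) / (ln r)%:E)%E 0^'+.

Definition lower_minkowski_dim : \bar R :=
  limf_einf (fun r : R => lne (min_ball_measure r) / (ln r)%:E)%E 0^'+.

End minkowski_dimension.

Section cover_exponents.
Context {R : realType} (L : set R) (f : R -> R) (x : R).

Definition upper_cover_exponent : \bar R :=
  limf_esup (fun r : R => lne (cover_time L f r x) / (- ln r)%:E)%E 0^'+.

Definition lower_cover_exponent : \bar R :=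
  limf_einf (fun r : R => lne (cover_time L f r x) / (- ln r)%:E)%E 0^'+.

End cover_exponents.

(* Main.v *)
Require Import Defs.
From HB Require Import structures.
From mathcomp Require Import all_boot all_order all_algebra.
From mathcomp Require Import all_classical all_reals all_analysis.
From mathcomp Require Import measurable_realfun ring lra.

Set Implicit Arguments.
Unset Strict Implicit.
Unset Printing Implicit Defensive.

Import Order.TTheory GRing.Theory Num.Theory numFieldNormedType.Exports.
Local Open Scope classical_set_scope.
Local Open Scope ring_scope.

(* For small r, almost every x satisfies, up to constants and a factor
   (ln r)^2, the two-sided estimate 1 / M(4 r) <= tau_r(x) <= 1 / M(r / 8),
     where
   M(r) is the least measure of a ball of radius r centred in the support; both
   limits are invariant under rescaling r, and the errors vanish because
   ln M(r) / ln r is bounded.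
   Lower estimate: by invariance a ball of measure at most 2 M(r) is hit before
   time k with probability at most 2 k M(r); take r = 2^-n,
   k = 1 / (n^2 M(r)) and apply Borel-Cantelli.
   Upper estimate: fix a gap q with psi(q) <= 1/2. A ball of radius 2 s contains
   a union of cylinders of length n = O(log(1/s)) of measure u at least M(s),
     and
   the orbit avoids it at the T + 1 times 0, n + q, 2 (n + q), ... with
   probability at most (1 - u / 2)^T. With T of order log(1/s) / M(s), the sum
   over O(1/s) balls covering the repeller is summable along s = 2^-n. *)

(** * Expanding Markov maps *)

Lemma derivable_interior (R : realType) (I : set R) (g : R -> R) (c l : R) :
  interior I c ->
  (g y - g c) / (y - c) @[y --> within I c^'] --> l -> is_derive c 1 g l.
Proof.
move=> Ic H.
have K : h^-1 *: ((g \o shift c) (h *: 1) - g c) @[h --> 0^'] --> l.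
  have -> : (fun h => h^-1 *: ((g \o shift c) (h *: 1) - g c)) =
            (fun y => (g y - g c) / (y - c)) \o (fun h => h + c).
    by apply/funext => h /=; rewrite scaler1 addrK /GRing.scale /= mulrC.
  apply: cvg_comp H => B BI.
  have BI' : \forall y \near c, y != c -> I y -> B y by exact: BI.
  have Ic' : \forall y \near c, I y by exact: Ic.
  suff : \forall h \near 0, h != 0 -> B (h + c) by [].
  move: BI' Ic'; rewrite !(near_shift 0 c) subr0 => BI' Ic'.
  apply: filterS2 BI' Ic' => h /= BI' Ih h0; apply: BI' => //.
  by rewrite -subr_eq0 addrK.
by split; [apply/cvg_ex; exists l | apply/cvg_lim].
Qed.

(** Mean value theorem on [[x, y]]. The intermediate point is interior to [I], where the difference
    quotient restricted to [I] yields the ordinary derivative. *)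
Lemma expanding_dist (R : realType) (I : set R) (g : R -> R) (gamma : R) :
  is_interval I -> {within I, continuous g} ->
  (forall x, I x -> exists2 l : R,
     (g y - g x) / (y - x) @[y --> within I x^'] --> l & gamma <= `|l|) ->
  forall x y, I x -> I y -> gamma * `|x - y| <= `|g x - g y|.
Proof.
move=> itvI cg dg x y; wlog xy : x y / x < y => [hw|] Ix Iy.
  case: (ltgtP x y) => [xy|yx|->].
  - exact: hw.
  - by rewrite distrC [leRHS]distrC; exact: hw.
  - by rewrite !subrr normr0 mulr0.
have xyI : `[x, y] `<=` I.
  by move=> z /=; rewrite in_itv/= => xzy; exact: itvI xzy.
have ooI z : z \in `]x, y[ -> I z.
  by move=> zxy; apply: xyI; move: zxy; rewrite /= !in_itv/= => /andP[/ltW->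
    /ltW->].
(* Membership in the open interval is put under the existential, so that a derivative function can
   be chosen on all of [R]; its value elsewhere is a dummy. *)
have dgc c : exists l : R, c \in `]x, y[ -> is_derive c 1 g l /\ gamma <= `|l|.
  case: (boolP (c \in `]x, y[)) => cxy; last by exists 0.
  have Ic : I c by exact: ooI.
  have [l dl gl] := dg _ Ic; exists l => _; split => //.
  apply: derivable_interior dl; rewrite /interior /=.
  apply: filterS (near_in_itvoo cxy) => z zxy.
  exact: ooI.
pose df c := projT1 (cid (dgc c)).
have dfP c : c \in `]x, y[ -> is_derive c 1 g (df c) /\ gamma <= `|df c|.
  exact: projT2 (cid (dgc c)).
have [||c cxy E] := @MVT _ g df x y xy.
- by move=> c /dfP[].
- exact: continuous_subspaceW cg.
rewrite distrC [leRHS]distrC E normrM ler_wpM2r//.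
by have [_] := dfP _ cxy.
Qed.

Section markov_orbits.
Context {R : realType} {A : pointedType} {P : A -> set R} {X : set R}
  {f : R -> R}.
Hypothesis countableA : countable [set: A].
Hypothesis markov_f : piecewise_expanding_markov P X f.

Let XE : X = \bigcup_a P a. Proof. by case: markov_f => -[]. Qed.

Lemma markov_iter x k : X x -> X (iter k f x).
Proof.
have fX y : X y -> X (f y).
  rewrite {1}XE => -[a _ Pay]; case: markov_f => _ _ mf _.
  have [_ _ [B fP]] := mf a; have : (f @` P a) (f y) by exists y.
  by rewrite fP XE => -[b _ Pb]; exists b.
by elim: k => //= k IH /IH; exact: fX.
Qed.

(** The image of a piece is a union of pieces, so no orbit leaves [X]. This allows the estimates
    below to be stated for [X] instead of the repeller. *)
Lemma markov_repeller : repeller P X f = X.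
Proof.
apply/seteqP; split => [x []//|x Xx]; split=> // k.
by rewrite -XE; exact: markov_iter.
Qed.

Lemma markov_itinerary x : X x -> exists w : nat -> A, coded_points P f w x.
Proof.
move=> Xx; have /choice[w wP] : forall k, exists a, P a (iter k f x).
  by move=> k; have := markov_iter k Xx; rewrite {1}XE => -[a _ Pa]; exists a.
by exists w => k _; exact: wP.
Qed.

Lemma itinerary_admissible (w : nat -> A) x :
  coded_points P f w x -> shift_space P f w.
Proof.
move=> wx k; rewrite /transition_matrix; case: asboolP => // -[].
exists (iter k.+1 f x); split; last exact: wx.
by exists (iter k f x) => //; exact: wx.
Qed.

Let itvP a : is_interval (P a).
Proof. by case: markov_f => -[iP _ _] _ _ _; case: (iP a). Qed.

Lemma markov_measurable_piece a : measurable (P a : set (measurableTypeR R)).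
Proof. exact: is_interval_measurable (@itvP a). Qed.

Lemma markov_measurable : measurable (X : set (measurableTypeR R)).
Proof.
rewrite XE; apply: countable_bigcupT_measurable => //.
exact: markov_measurable_piece.
Qed.

(** [f] is continuous on each piece only, so the preimage is cut along the countably many pieces,
    which are intervals. *)
Lemma markov_measurable_preimage (B : set (measurableTypeR R)) :
  measurable B -> measurable (X `&` f @^-1` B).
Proof.
move=> mB; rewrite XE setI_bigcupl; apply: countable_bigcupT_measurable => // a.
have mPa := markov_measurable_piece a.
apply: (@subspace_continuous_measurable_fun R (P a) f) => //.
by case: markov_f => _ _ mf _; case: (mf a).
Qed.

(** Isolates the last application of [f] in the form that occurs in [invariant_measure]. *)
Lemma preimage_iterS (B : set R) k : X `&` iter k.+1 f @^-1` B =
  X `&` iter k f @^-1` (X `&` f @^-1` B).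
Proof.
apply/seteqP; split=> x [Xx] /=; first by move=> Bx; do !split => //;
  exact: markov_iter.
by case.
Qed.

Lemma markov_measurable_iter (B : set (measurableTypeR R)) k :
  measurable B -> measurable (X `&` iter k f @^-1` B : set (measurableTypeR R)).
Proof.
elim: k B => [|k IH] B mB.
  by apply: measurableI => //; exact: markov_measurable.
by rewrite preimage_iterS; apply: IH; exact: markov_measurable_preimage.
Qed.

Lemma invariant_iter (mu : probability (measurableTypeR R) R)
    (B : set (measurableTypeR R)) k : invariant_measure X f mu ->
  measurable B -> mu (X `&` iter k f @^-1` B) = mu B.
Proof.
(* Invariance applied to the whole line; full measure of [X] settles the case [k = 0]. *)
move=> invmu; have muX : mu X = 1%E.
  by have := invmu _ measurableT; rewrite preimage_setT setIT probability_setT.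
elim: k B => [|k IH] B mB.
  have mX := markov_measurable.
  have muXC : mu (~` X) = 0%E by rewrite probability_setC// muX subee.
  rewrite /= -[in RHS](setIT B) -(setUCr X) setIUr setIC.
  rewrite measureU0//; [exact: measurableI|by apply: measurableI => //;
    exact: measurableC|].
  apply/eqP; rewrite eq_le measure_ge0 andbT -muXC le_measure ?inE//.
  - by apply: measurableI => //; exact: measurableC.
  - exact: measurableC.
by rewrite preimage_iterS IH ?invmu//; exact: markov_measurable_preimage.
Qed.

(** Each of the first [n] steps expands the distance by [gamma], and the [n]-th iterates still lie
    in [[0, 1]], at distance at most 1. *)
Lemma itinerary_dist : exists2 gamma : R, 1 < gamma &
  forall (w : nat -> A) n x y,
    (forall k, (k <= n)%N -> P (w k) (iter k f x)) ->
    (forall k, (k <= n)%N -> P (w k) (iter k f y)) ->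
    `|x - y| <= gamma ^- n.
Proof.
case: (markov_f) => -[iP _ _] _ mf [gamma gamma1 df].
have gamma0 : 0 < gamma by apply: lt_trans gamma1.
exists gamma => // w n x y wx wy.
have step k : (k <= n)%N -> gamma ^+ k * `|x - y| <= `|iter k f x - iter k f y|.
  elim: k => [|k IH] kn; first by rewrite expr0 mul1r.
  rewrite exprS -mulrA (le_trans (ler_wpM2l (ltW gamma0) (IH (ltnW kn))))//.
  have [cf _ _] := mf (w k).
  by apply: (expanding_dist (itvP (a := w k)) cf (df (w k)));
    [apply: wx|apply: wy]; exact: ltnW.
rewrite -[leRHS]mul1r ler_pdivlMr ?exprn_gt0// mulrC (le_trans (step _ (leqnn
  n)))//.
have P01 a : P a `<=` `[0, 1] by case: (iP a).
move: (P01 _ _ (wx n (leqnn n))) (P01 _ _ (wy n (leqnn n))).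
rewrite /= !in_itv/= => /andP[x0 x1] /andP[y0 y1].
by rewrite ler_norml; apply/andP; split; lra.
Qed.

(** A piece has nonempty interior. Two distinct points rule out a cover time of 0 at small radii. *)
Lemma markov_two_points : exists x y, [/\ X x, X y & x < y].
Proof.
have [[/(_ point)[_ _ [x Px] _ XE']] _ _ _] := markov_f.
have [e /= e0 eP] := (nbhs_ballP _ _).1 Px.
exists x, (x + e / 2); split; last by rewrite ltrDl divr_gt0.
- by rewrite XE; exists point => //; exact: interior_subset.
- rewrite XE; exists point => //; apply: eP;
    rewrite /ball/= opprD addNKr normrN.
  by rewrite gtr0_norm ?divr_gt0//; lra.
Qed.

Lemma markov_unit x : X x -> 0 <= x <= 1.
Proof.
case: (markov_f) => -[iP _ _] _ _ _; rewrite XE => -[a _ Pa].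
by have [_ P01 _] := iP a; have := P01 _ Pa; rewrite /= in_itv.
Qed.

End markov_orbits.

(** * Limits at 0 from the right *)

Section right_limits.
Local Open Scope ereal_scope.
Context {R : realType}.
Implicit Types (G H : R -> \bar R).

Lemma near0_rightP (Q : R -> Prop) :
  (\forall r \near (0 : R)^'+, Q r) <->
  exists2 d : R, (0 < d)%R & forall r, (0 < r < d)%R -> Q r.
Proof.
split=> [[d /= d0 dQ]|[d d0 dQ]]; exists d => //= r.
- move=> /andP[r0 rd]; apply: dQ => //=.
  by rewrite /ball/= sub0r normrN gtr0_norm.
- by rewrite /ball/= sub0r normrN => rd r0; apply: dQ;
    rewrite r0 (le_lt_trans _ rd)// ler_norm.
Qed.

(** Scaling by [c] maps right neighbourhoods of 0 to right neighbourhoods of 0, so [G] and its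
    rescaling have the same upper and lower limits, and [e] is arbitrary. *)
Lemma limf_right_le G H (c : R) : (0 < c)%R ->
  (forall e : R, (0 < e)%R ->
     \forall r \near (0 : R)^'+, G (c * r)%R <= H r + e%:E) ->
  limf_esup G (0 : R)^'+ <= limf_esup H (0 : R)^'+ /\
  limf_einf G (0 : R)^'+ <= limf_einf H (0 : R)^'+.
Proof.
move=> c0 GH; split; apply/lee_addgt0Pr => e e0;
  have /near0_rightP[d d0 dGH] := GH _ e0.
- rewrite -leeBlDr// limf_esupE [leRHS]limf_esupE.
  apply: le_ereal_inf_tmp => _ [V /near0_rightP[d' d'0 d'V] <-].
  rewrite leeBlDr//.
  pose W := [set r : R | (0 < r / c < Num.min d d')%R].
  apply: le_trans (_ : ereal_sup (G @` W) <= _).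
    apply: ereal_inf_lbound; exists W => //; apply/near0_rightP.
    exists (c * Num.min d d')%R; first by rewrite mulr_gt0// lt_min d0.
    move=> r /andP[r0 rm]; rewrite /W/= divr_gt0//=.
    by rewrite ltr_pdivrMr// mulrC.
  apply: ge_ereal_sup => _ [r + <-]; rewrite /W/= lt_min => /and3P[r0 rd rd'].
  rewrite [X in G X](_ : r = (c * (r / c))%R);
    last by rewrite mulrC divfK ?gt_eqF.
  rewrite (le_trans (dGH _ _)) ?r0// leeD2r//; apply: ereal_sup_ubound.
  by exists (r / c)%R => //; apply: d'V; rewrite r0.
- rewrite limf_einfE; apply: ge_ereal_sup => _ [V /near0_rightP[d' d'0 d'V] <-].
  rewrite -leeBlDr// [leRHS]limf_einfE.
  pose W := [set r : R | (0 < r < Num.min d (d' / c))%R].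
  apply: le_trans (_ : ereal_inf (H @` W) <= _); last first.
    apply: ereal_sup_ubound; exists W => //; apply/near0_rightP.
    by exists (Num.min d (d' / c))%R; rewrite ?lt_min ?d0 ?divr_gt0.
  apply: le_ereal_inf_tmp => _ [r + <-]; rewrite /W/= lt_min => /and3P[r0 rd
    rd'].
  rewrite EFinN leeBlDr//; apply: le_trans (dGH _ _); last by rewrite r0.
  apply: ereal_inf_lbound; exists (c * r)%R => //; apply: d'V.
  by rewrite mulr_gt0//= mulrC -ltr_pdivlMr.
Qed.

(* [expR x >= (1 + x / 3) ^+ 3] beats any quadratic. *)
Lemma sqr_le_expR (C e : R) : (0 < e)%R ->
  exists2 T : R, (0 < T)%R & forall t, (T <= t -> C * t ^+ 2 <= expR (e * t))%R.
Proof.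
move=> e0; pose T : R := (1 + `|C| * (3 / e) ^+ 3)%R.
have T0 : (0 < T)%R by rewrite ltr_pwDl// mulr_ge0// exprn_ge0// divr_ge0// ltW.
exists T => // t Tt; have t0 := lt_le_trans T0 Tt.
have -> : (e * t = 3%:R * (e * t / 3))%R by field.
apply: (@le_trans _ _ ((e * t / 3) ^+ 3)%R).
  have -> : ((e * t / 3) ^+ 3 = (t * ((e / 3) ^+ 3)) * t ^+ 2)%R by field.
  rewrite ler_wpM2r ?sqr_ge0// -ler_pdivrMr ?exprn_gt0 ?divr_gt0//.
  apply: le_trans Tt; rewrite /T -exprVn invf_div.
  rewrite (le_trans (ler_wpM2r _ (ler_norm C)))//; last by rewrite lerDr.
  by rewrite exprn_ge0// divr_ge0// ltW.
rewrite expRM_natl lerXn2r// ?nnegrE ?expR_ge0//.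
- by rewrite divr_ge0// mulr_ge0// ltW.
- by rewrite (le_trans _ (expR_ge1Dx _))// lerDr.
Qed.

End right_limits.

(** * Almost everywhere statements *)

Lemma aeS d (T : measurableType d) (R : realType)
    (mu : {measure set T -> \bar R}) (Q Q' : T -> Prop) :
  (forall x, Q x -> Q' x) -> {ae mu, forall x, Q x} -> {ae mu, forall x, Q' x}.
Proof. by move=> QQ'; apply: negligibleS => x /=;
  apply: contra_not => /QQ'. Qed.

Lemma aeI d (T : measurableType d) (R : realType)
    (mu : {measure set T -> \bar R}) (Q Q' : T -> Prop) :
  {ae mu, forall x, Q x} -> {ae mu, forall x, Q' x} ->
  {ae mu, forall x, Q x /\ Q' x}.
Proof.
move=> aeQ aeQ'; apply: negligibleS (negligibleU aeQ aeQ') => x /= /not_andP[].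
  by left.
by right.
Qed.

(** Serves to compare [mu] with the symbolic measure, whose sequences code a point only almost
    surely. *)
Lemma ae_le_measure d (T : measurableType d) (R : realType)
    (mu : {measure set T -> \bar R}) (Q : T -> Prop) (B B' : set T) :
  measurable B -> measurable B' -> {ae mu, forall x, Q x} ->
  (forall x, Q x -> B x -> B' x) -> (mu B <= mu B')%E.
Proof.
move=> mB mB' [N [mN N0 QN]] BB'; rewrite -(measureU0 (mu := mu) mB' mN N0).
apply: le_measure; rewrite ?inE//; first exact: measurableU.
move=> x Bx; have [Qx|nQx] := pselect (Q x); first by left; exact: BB'.
by right; exact: QN.
Qed.

(** Telescoping, since [1 / (x + 1)^2] is less than [1 / x - 1 / (x + 1)]. *)
Lemma sum_inv_sqr_le (R : realType) n :
  \sum_(0 <= i < n.+1) (i.+1%:R ^- 2 : R) <= 2 - n.+1%:R^-1.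
Proof.
elim: n => [|n IH]; first by rewrite big_nat1 expr1n invr1; lra.
rewrite big_nat_recr//= (le_trans (lerD IH (lexx _)))//.
have x0 : 0 < n.+1%:R :> R by rewrite ltr0n.
rewrite -(natr1 n.+1); set x := n.+1%:R in x0 *.
have x1 : 0 < x + 1 by rewrite addr_gt0.
have -> : (x + 1) ^- 2 = x^-1 - (x + 1)^-1 - (x * (x + 1) ^+ 2)^-1.
  by field; rewrite !gt_eqF.
have : 0 < (x * (x + 1) ^+ 2)^-1 by rewrite invr_gt0 mulr_gt0// exprn_gt0.
by move: _^-1 => a; move: (x + 1)^-1 x^-1 => b c; lra.
Qed.

Lemma borel_cantelli_sqr d (T : measurableType d) (R : realType)
    (mu : {measure set T -> \bar R}) (F : (set T)^nat) (C : R) :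
  (forall n, measurable (F n)) ->
  (forall n, mu (F n) <= (C * n.+1%:R ^- 2)%:E)%E ->
  {ae mu, forall x, exists N, forall n, (N <= n)%N -> ~ F n x}.
Proof.
move=> mF muF.
have C0 : 0 <= C.
  have := le_trans (measure_ge0 mu (F 0)) (muF 0).
  by rewrite lee_fin expr1n invr1 mulr1.
have sumF : (\sum_(n <oo) mu (F n) < +oo)%E.
  apply: (@le_lt_trans _ _ (C * 2)%:E); last by rewrite ltry.
  apply: lime_le; first exact: is_cvg_nneseries.
  apply: nearW => -[|n]; first by rewrite big_geq// lee_fin mulr_ge0.
  apply: (@le_trans _ _ (\sum_(0 <= i < n.+1) (C * i.+1%:R ^- 2)%:E)%E).
    by apply: lee_sum => i _; exact: muF.
  rewrite sumEFin lee_fin -mulr_sumr ler_wpM2l//.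
  by rewrite (le_trans (sum_inv_sqr_le R n))// gerBl.
exists (lim_sup_set F); split.
- by apply: bigcap_measurable => //= k _; apply: bigcup_measurable => j _;
    exact: mF.
- exact: lim_sup_set_cvg0.
- move=> x /= nx N _; apply: contrapT => nFx; apply: nx; exists N => n Nn Fx.
  by apply: nFx; exists n.
Qed.

(** * Comparison with the Minkowski dimensions *)

Section dimension_comparison.
Context {R : realType} (mu : probability (measurableTypeR R) R).
Local Notation M := (min_ball_measure mu).

Lemma min_ball_measure_ge0 r : (0 <= M r)%E.
Proof. by apply: le_ereal_inf_tmp => _ [x _ <-]; exact: measure_ge0. Qed.

Lemma measurable_ballR (x r : R) :
  measurable (ball x r : set (measurableTypeR R)).
Proof. exact: measurable_ball. Qed.

Lemma min_ball_measure_le r s : r <= s -> (M r <= M s)%E.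
Proof.
move=> rs; apply: le_ereal_inf_tmp => _ [x xs <-].
apply: (@le_trans _ _ (mu (ball x r))); first by apply: ereal_inf_lbound;
  exists x.
by apply: le_measure; rewrite ?inE; [exact: measurable_ballR..|exact: le_ball].
Qed.

Hypothesis supp0 : measure_support mu !=set0.

Lemma min_ball_measure_le1 r : (M r <= 1)%E.
Proof.
have [x xs] := supp0; apply: (@le_trans _ _ (mu (ball x r))).
  by apply: ereal_inf_lbound; exists x.
by apply: probability_le1; exact: measurable_ballR.
Qed.

Hypothesis finite_dim : (upper_minkowski_dim mu < +oo)%E.

(** A finite upper limit bounds the quotient near 0; [M r = 0] would make the quotient [+oo]. *)
Lemma min_ball_measure_bound : exists2 D : R, 0 <= D &
  \forall r \near 0^'+, r < 1 /\ exists m : R,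
    [/\ 0 < m, m <= 1, M r = m%:E & - ln m <= D * - ln r].
Proof.
move: finite_dim; rewrite /upper_minkowski_dim limf_esupE => /ereal_inf_lt[_ [V
  V0 <-]] supV.
pose S := ereal_sup ((fun r => lne (M r) / (ln r)%:E)%E @` V).
(* The maximum with 0 excludes [-oo], so that [fine] loses nothing. *)
exists (fine (maxe S 0)); first by rewrite fine_ge0// le_max lexx orbT.
have Sfin : maxe S 0 \is a fin_num.
  by rewrite ge0_fin_numE ?le_max ?lexx ?orbT// gt_max supV ltry.
have lt1 : \forall r \near (0 : R)^'+, r < 1 by exact: nbhs_right_lt.
have gt0 : \forall r \near (0 : R)^'+, 0 < r by exact: nbhs_right_gt.
near=> r; split; first by near: r.
have r1 : r < 1 by near: r.
have r0 : 0 < r by near: r.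
have lnr : ln r < 0 by rewrite ln_lt0// r0.
have : (lne (M r) / (ln r)%:E <= maxe S 0)%E.
  rewrite le_max; apply/orP; left; apply: ereal_sup_ubound; exists r => //.
  by near: r.
have := min_ball_measure_le1 r; have := min_ball_measure_ge0 r.
rewrite inver lt_eqF//; case: (M r) => // m; rewrite !lee_fin => m0 m1.
move: m0; rewrite le_eqVlt => /orP[/eqP<-|m0].
  rewrite /= lexx lt0_mulNye ?lte_fin ?invr_lt0// leye_eq => /eqP Sy.
  by rewrite Sy in Sfin.
rewrite lne_EFin// -(fineK Sfin) lee_fin => lnm; exists m; split => //.
by rewrite mulrN lerN2 -ler_ndivrMr.
Unshelve. all: by end_near. Qed.


Lemma near0_right_slack (C D c e : R) : 0 < C -> 0 < c -> 0 < e ->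
  \forall r \near 0^'+,
    [/\ 0 < r < 1, 0 < c * r < 1, ln (C * ln r ^+ 2) <= e * - ln r &
         D * `|ln c| <= e * - ln r].
Proof.
move=> C0 c0 e0; have [T T0 HT] := sqr_le_expR C e0.
pose S := Num.max T (`|D| * `|ln c| / e).
apply/near0_rightP; exists (Num.min (expR (- S)) (Num.min 1 c^-1)).
  by rewrite !lt_min expR_gt0 ltr01 invr_gt0.
move=> r /andP[r0]; rewrite !lt_min => /and3P[rS r1 rc].
have lr : S <= - ln r by rewrite lerNr -ler_expR lnK// ltW.
have [ST Sc] : T <= - ln r /\ `|D| * `|ln c| / e <= - ln r.
  by move: lr; rewrite ge_max => /andP.
have lr0 : 0 < - ln r := lt_le_trans T0 ST.
split; first by rewrite r0.
- by rewrite mulr_gt0//= -[ltRHS](mulfV (lt0r_neq0 c0)) ltr_pM2l.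
- rewrite -ler_expR lnK; last by rewrite posrE mulr_gt0// exprn_even_gt0//=
    -oppr_eq0 gt_eqF.
  by rewrite -[ln r ^+ 2]sqrrN HT.
- move: Sc; rewrite ler_pdivrMr// [leRHS]mulrC; apply: le_trans.
  by rewrite ler_wpM2r// ler_norm.
Qed.

(* Applied to [p = - ln (M s)], [q = - ln s] and [L = - ln r], where [r] is a
   fixed multiple of [s]. *)
Lemma ratio_close (D e L q p : R) : 0 < L -> 0 < q -> 0 <= p -> p <= D * q ->
  D * `|q - L| <= e * L -> `|p / L - p / q| <= e.
Proof.
move=> L0 q0 p0 pD De.
have -> : p / L - p / q = (p / q) * (q - L) / L by field; rewrite !gt_eqF.
rewrite normrM (normrM (p / q)) (gtr0_norm (_ : 0 < L^-1)) ?invr_gt0//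
  ler_pdivrMr//.
apply: le_trans De; rewrite ler_wpM2r// ger0_norm ?divr_ge0 ?(ltW q0)//.
by rewrite ler_pdivrMr.
Qed.

Lemma near0_right_scale (Q : R -> Prop) (c : R) : 0 < c ->
  (\forall r \near 0^'+, Q r) -> \forall r \near 0^'+, Q (c * r).
Proof.
move=> c0 /near0_rightP[d d0 dQ]; apply/near0_rightP; exists (d / c).
  by rewrite divr_gt0.
move=> r /andP[r0]; rewrite ltr_pdivlMr// mulrC => rd.
by apply: dQ; rewrite rd mulr_gt0.
Qed.

(** Shared by the two comparisons below: relative to [- ln r], the factor [C (ln r)^2] costs at most
    [e], and replacing [ln (c r)] by [ln r] in the quotient costs at most another [e]. *)
Let cover_exponent_near (C c e : R) : 0 < C -> 0 < c -> 0 < e ->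
  \forall r \near 0^'+, 0 < - ln r /\ exists m : R,
    [/\ 0 < C * ln r ^+ 2, 0 < m, M (c * r) = m%:E,
      ln (C * ln r ^+ 2) <= e * - ln r &
      (lne (M (c * r)) / (ln (c * r))%:E = (ln m / ln (c * r))%:E)%E /\
      `|- ln m / - ln r - ln m / ln (c * r)| <= e].
Proof.
move=> C0 c0 e0; have [D D0 MD] := min_ball_measure_bound.
have := near0_right_slack D C0 c0 e0.
apply: filterS2 (near0_right_scale c0 MD) => r [_ [m [m0 m1 Mm lnm]]].
move=> [/andP[r0 r1] cr01 slC slD].
have cr0 : ln (c * r) < 0 by exact: ln_lt0.
have lr0 : ln r < 0 by rewrite ln_lt0// r0.
split; first by rewrite oppr_gt0.
exists m; split => //.
  by rewrite mulr_gt0// exprn_even_gt0//= lt_eqF.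
split; first by rewrite Mm lne_EFin// inver lt_eqF// -EFinM.
  rewrite -[ln m / ln _]mulrNN -invrN.
  apply: (ratio_close (D := D)) => //; rewrite ?oppr_gt0// ?oppr_ge0 ?ln_le0//.
  by rewrite lnM ?posrE// opprD addrK normrN.
Qed.

Lemma cover_exponent_ge (tau : R -> \bar R) (C c : R) : 0 < C -> 0 < c ->
  (\forall r \near 0^'+, forall m, 0 < m -> M (c * r) = m%:E ->
     ((C * ln r ^+ 2 * m)^-1%:E <= tau r)%E) ->
  (upper_minkowski_dim mu <=
     limf_esup (fun r => lne (tau r) / (- ln r)%:E) 0^'+)%E /\
  (lower_minkowski_dim mu <=
     limf_einf (fun r => lne (tau r) / (- ln r)%:E) 0^'+)%E.
Proof.
move=> C0 c0 tauC; apply: (limf_right_le c0) => e e0.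
(* One half pays for the logarithmic factor, the other for the rescaling. *)
have e20 : 0 < e / 2 by rewrite divr_gt0.
apply: filterS2 tauC (cover_exponent_near C0 c0 e20).
move=> r tauC [lr0 [m [K0 m0 Mm slC [-> close]]]].
have {tauC}Km := tauC _ m0 Mm.
have Km0 : 0 < C * ln r ^+ 2 * m by rewrite mulr_gt0.
apply: (@le_trans _ _ (- ln (C * ln r ^+ 2 * m) / - ln r + e)%:E).
  rewrite lee_fin [ln (_ * m)]lnM ?posrE// opprD mulrDl.
  have : ln (C * ln r ^+ 2) / - ln r <= e / 2 by rewrite ler_pdivrMr.
  by rewrite mulNr; move: close; rewrite ler_norml => /andP[]; lra.
rewrite EFinD leeD2r// inver gt_eqF// EFinM lee_wpmul2r//;
  first by rewrite lee_fin invr_ge0 ltW.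
rewrite -lnV ?posrE// -lne_EFin ?invr_gt0// lee_lne//.
  by rewrite in_itv/= lee_fin invr_ge0 ltW//= leey.
by rewrite in_itv/= leey andbT (le_trans _ Km)// lee_fin invr_ge0 ltW.
Qed.

Lemma cover_exponent_le (tau : R -> \bar R) (C c : R) : 0 < C -> 0 < c ->
  (\forall r \near 0^'+, (0 <= tau r)%E) ->
  (\forall r \near 0^'+, forall m, 0 < m -> M (c * r) = m%:E ->
     (tau r <= (C * ln r ^+ 2 / m)%:E)%E) ->
  (limf_esup (fun r => lne (tau r) / (- ln r)%:E) 0^'+ <=
     upper_minkowski_dim mu)%E /\
  (limf_einf (fun r => lne (tau r) / (- ln r)%:E) 0^'+ <=
     lower_minkowski_dim mu)%E.
Proof.
move=> C0 c0 tau0 tauC; have c'0 : 0 < c^-1 by rewrite invr_gt0.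
(* The rescaling now falls on [tau]: it is evaluated at [r = c^-1 s], where [M (c r)] is [M s]. *)
apply: (limf_right_le c'0) => e e0.
have e20 : 0 < e / 2 by rewrite divr_gt0.
have near_r := near0_right_scale c'0 (cover_exponent_near C0 c0 e20).
apply: filterS3 (near0_right_scale c'0 tau0) (near0_right_scale c'0 tauC)
  near_r.
move=> s /=; rewrite mulVKf ?gt_eqF//; set r := c^-1 * s.
move=> {}tau0 {}tauC [lr0 [m [K0 m0 Mm slC [-> close]]]].
have {tauC}Km := tauC _ m0 Mm.
have Km0 : 0 < C * ln r ^+ 2 / m by rewrite divr_gt0.
apply: (@le_trans _ _ (ln (C * ln r ^+ 2 / m) / - ln r)%:E); last first.
  rewrite -EFinD lee_fin [ln (_ * m^-1)]lnM ?posrE ?invr_gt0// (lnV (x := m))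
    ?posrE// mulrDl.
  have : ln (C * ln r ^+ 2) / - ln r <= e / 2 by rewrite ler_pdivrMr.
  by move: close; rewrite ler_norml => /andP[]; lra.
rewrite inver gt_eqF// EFinM lee_wpmul2r//;
  first by rewrite lee_fin invr_ge0 ltW.
rewrite -lne_EFin// lee_lne//.
  by rewrite in_itv/= leey tau0.
by rewrite in_itv/= leey andbT lee_fin ltW.
Qed.

End dimension_comparison.

(** * Dyadic scales *)

Section dyadic.
Context {R : realType}.

(** [n.+1] is the least exponent whose power is below [r]. *)
Lemma dyadic_scale (r : R) N : 0 < r -> r <= 2 ^- N ->
  exists2 n, (N <= n)%N & 2 ^- n.+1 < r <= 2 ^- n.
Proof.
move=> r0 rN.
have exn : exists n, 2 ^- n < r.
  have [n rn] : exists n, r^-1 < n%:R by exists (Num.truncn r^-1).+1;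
    exact: truncnS_gt.
  exists n; rewrite -[ltRHS]invrK ltf_pV2 ?posrE ?exprn_gt0 ?invr_gt0//.
  by rewrite (lt_le_trans rn)// -natrX ler_nat ltnW// ltn_expl.
case: (ex_minnP exn) => -[|n] rn minn.
  by have := lt_le_trans rn rN; rewrite ltf_pV2 ?posrE ?exprn_gt0// expr0 ltNge
    exprn_ege1// ler1n.
exists n; last by rewrite rn leNgt; apply/negP => /minn; rewrite ltnn.
rewrite leqNgt; apply/negP => nN; have := lt_le_trans rn rN.
by rewrite ltf_pV2 ?posrE ?exprn_gt0// ltr_eXn2l ?ltr1n// ltnNge nN.
Qed.

(** Follows from [ln 2 >= 1 / 2]; it turns the squares of dyadic exponents into multiples of
    [(ln r)^2]. *)
Lemma dyadic_ln (r : R) n : 0 < r -> r <= 2 ^- n -> n%:R <= 2 * - ln r.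
Proof.
move=> r0 rn.
have ln2 : 1 / 2 <= ln (2 : R).
  rewrite -[ln 2]opprK -lnV ?posrE//.
  have : ln (1 + (- (1 / 2)) : R) <= - (1 / 2) by apply: le_ln1Dx; lra.
  have -> : (1 + - (1 / 2) : R) = 2^-1 by lra.
  by lra.
have : ln r <= - (n%:R * ln 2).
  rewrite mulr_natl -lnXn// -lnV ?posrE ?exprn_gt0// ler_ln ?posrE ?invr_gt0
    ?exprn_gt0//.
have n0 : 0 <= n%:R :> R by [].
nra.
Qed.

End dyadic.

(** * Lower estimate *)

Section lower_bounds.
Context {R : realType} {A : pointedType} {P : A -> set R} {X : set R}
  {f : R -> R} {mu : probability (measurableTypeR R) R}.
Hypothesis countableA : countable [set: A].
Hypothesis markov_f : piecewise_expanding_markov P X f.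
Local Notation M := (min_ball_measure mu).

(** Positivity at small radii carries over to all larger ones by monotonicity. *)
Lemma min_ball_measure_gt0 (r : R) : measure_support mu !=set0 ->
  (upper_minkowski_dim mu < +oo)%E -> 0 < r ->
  exists m : R, [/\ 0 < m, m <= 1 & M r = m%:E].
Proof.
move=> supp0 fin r0; have [D _] := min_ball_measure_bound supp0 fin.
move=> /near0_rightP[d d0 dM]; pose s := Num.min r (d / 2).
have s0 : 0 < s by rewrite lt_min r0 divr_gt0.
have sd : s < d by rewrite gt_min ltr_pdivrMr// ltr_pMr// ltr1n orbT.
have [|_ [m [m0 _ Ms _]]] := dM s; first by rewrite s0.
have := min_ball_measure_le mu (_ : s <= r); rewrite ge_min lexx Ms => /(_ isT).
have := min_ball_measure_le1 supp0 r; case: (M r) => // m'; rewrite !lee_fin.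
by move=> m'1 /(lt_le_trans m0) m'0; exists m'.
Qed.

(** Otherwise the ball would lie in the null complement of [X]. Needed because a centre in the
    support may lie outside [X], whereas the cover time concerns points of [X]. *)
Lemma support_ball_meets (z r : R) : mu X = 1%E -> measure_support mu z ->
  0 < r -> exists2 y, X y & ball z r y.
Proof.
move=> muX zs r0; apply: contrapT => nex.
have mB := measurable_ballR z r; have mX := markov_measurable countableA
  markov_f.
have sub : ball z r `<=` ~` X by move=> y By Xy; apply: nex; exists y.
have oB : open (ball z r) by exact: ball_open.
have := zs _ oB (ballxx z r0); apply/negP; rewrite -leNgt.
apply: le_trans (_ : mu (~` X) <= _)%E.
  by apply: le_measure; rewrite ?inE//; exact: measurableC.
by rewrite probability_setC// muX subee.
Qed.

Lemma early_hit_measure (B : set (measurableTypeR R)) k :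
  invariant_measure X f mu -> measurable B ->
  let E := [set x | X x /\ exists2 j, (j < k)%N & B (iter j f x)] in
  measurable (E : set (measurableTypeR R)) /\ (mu E <= k%:R%:E * mu B)%E.
Proof.
move=> inv mB E.
have -> : E = \big[setU/set0]_(j < k) (X `&` iter j f @^-1` B).
  rewrite -(bigcup_mkord k (fun j => X `&` iter j f @^-1` B)); apply/seteqP;
    split=> x.
    by move=> [Xx [j jk Bj]]; exists j.
  by move=> [j jk [Xx Bj]]; split=> //; exists j.
have mE j : measurable (X `&` iter j f @^-1` B : set (measurableTypeR R)).
  exact: (markov_measurable_iter countableA markov_f).
split; first by apply: bigsetU_measurable => j _; exact: mE.
apply: le_trans (Boole_inequality mu (fun j _ => mE j)) _.
rewrite (eq_bigr (fun=> mu B)); last first.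
  by move=> j _; exact: (invariant_iter countableA markov_f).
elim: {E mE} k => [|k IH]; first by rewrite big_ord0 mul0e.
by rewrite big_ord_recr/= -natr1 EFinD ge0_muleDl ?lee_fin// mul1e leeD2r.
Qed.

Lemma cover_time_ge : mu X = 1%E -> invariant_measure X f mu ->
  measure_support mu !=set0 -> (upper_minkowski_dim mu < +oo)%E ->
  {ae mu, forall x, X x -> \forall r \near 0^'+, forall m, 0 < m ->
    M (4 * r) = m%:E -> ((8 * ln r ^+ 2 * m)^-1%:E <= cover_time X f r x)%E}.
Proof.
move=> muX inv supp0 fin.
have /choice[m mP] : forall n, exists m : R, [/\ 0 < m, m <= 1 & M (2 ^- n) =
  m%:E].
  by move=> n; apply: min_ball_measure_gt0; rewrite // invr_gt0 exprn_gt0.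
have /choice[z zP] : forall n, exists z, measure_support mu z /\
    (mu (ball z (2 ^- n)) <= (2 * m n)%:E)%E.
  move=> n; have [m0 m1 Mn] := mP n.
  have : (M (2 ^- n) < (2 * m n)%:E)%E by rewrite Mn lte_fin ltr_pMl// ltr1n.
  by move=> /ereal_inf_lt[_ [z zs <-]] /ltW zm; exists z.
(* The time horizon for which the union bound [v n * (2 * m n)] equals [2 / (n + 1)^2]. *)
pose v n := (n.+1%:R ^+ 2 * m n)^-1.
have v0 n : 0 < v n by have [m0 _ _] := mP n;
  rewrite invr_gt0 mulr_gt0// exprn_gt0.
pose E n := [set x | X x /\ exists2 j, (j < Num.truncn (v n))%N &
                                      ball (z n) (2 ^- n) (iter j f x)].
have mE n := early_hit_measure (Num.truncn (v n)) inv (measurable_ballR (z n)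
  (2 ^- n)).
have [a [b [Xa Xb ab]]] := markov_two_points markov_f.
have : {ae mu, forall x, exists N, forall n, (N <= n)%N -> ~ E n x}.
  apply: (@borel_cantelli_sqr _ (measurableTypeR R) R mu E 2) => n;
    first by case: (mE n).
  have [m0 m1 Mn] := mP n; have [_ zn] := zP n; have [_ /le_trans] := mE n;
    apply.
  apply: le_trans (lee_wpmul2l _ zn) _; first by rewrite lee_fin.
  rewrite -EFinM lee_fin mulrCA ler_wpM2l// -ler_pdivlMr//.
  by have /andP[+ _] := truncn_itv (ltW (v0 n)); rewrite /v invfM.
apply: aeS => x [N nE] Xx; apply/near0_rightP.
(* The first bound makes the scale fine enough for Borel-Cantelli; the second prevents a single
   point from being [r]-close to both [a] and [b]. *)
exists (Num.min (2 ^- N.+1) ((b - a) / 2)).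
  by rewrite lt_min invr_gt0 exprn_gt0//= divr_gt0// subr_gt0.
move=> r /andP[r0]; rewrite lt_min => /andP[rN rab] m' m'0 Mr.
(* The dyadic exponent of [r] is [n.+1]: then [r + 2 ^- n.+1 <= 2 ^- n], which places the hit in the
   ball at scale [n], and [2 ^- n < 4 r], which gives [m n <= m']. *)
have [[//|n] Nn /andP[nr rn]] := dyadic_scale r0 (ltW rN).
have {}nE := nE n Nn; have [m0 m1 Mn] := mP n; have [zs _] := zP n.
have tn := dyadic_ln r0 rn.
have mm' : m n <= m'.
  rewrite -lee_fin -Mn -Mr; apply: min_ball_measure_le.
  by move: nr; rewrite !exprS !invfM => /ltW; set u := 2 ^- n; lra.
apply: le_ereal_inf_tmp => _ [k /= kP <-]; rewrite lee_fin.
have k0 : (0 < k)%N.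
  rewrite lt0n; apply/negP => /eqP k0.
  have [j] := kP _ Xa; rewrite k0 leqn0 => /eqP-> /= xa.
  have [j'] := kP _ Xb; rewrite k0 leqn0 => /eqP-> /= xb.
  by move: xa xb rab; rewrite !ltr_norml => /andP[? ?] /andP[? ?]; lra.
(* An orbit covering [X] by time [k] hits the ball at scale [n], so [k] is at least the truncation
   of [v n]; the rounding is absorbed by [k + 1 <= 2 k]. *)
have vk : v n <= 2 * k%:R.
  have kv : (Num.truncn (v n) <= k)%N.
    rewrite leqNgt; apply/negP => kv; apply: nE; split => //.
    have [|y Xy zy] := support_ball_meets muX zs (_ : 0 < 2 ^- n.+1).
      by rewrite invr_gt0 exprn_gt0.
    have [j jk xy] := kP _ Xy; exists j; first exact: leq_ltn_trans kv.
    have -> : 2 ^- n = 2 ^- n.+1 + 2 ^- n.+1 :> R by rewrite exprS invfM; lra.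
    by apply: (ball_triangle zy); rewrite /ball/= distrC (lt_le_trans xy).
  have /andP[_ /ltW/le_trans] := truncn_itv (ltW (v0 n)); apply.
  by rewrite -natrM ler_nat mul2n -addnn -addn1 leq_add.
have t0 : 0 < n.+1%:R :> R by [].
have Lt : n.+1%:R ^+ 2 <= 4 * ln r ^+ 2.
  have -> : 4 * ln r ^+ 2 = (2 * - ln r) ^+ 2 by ring.
  by rewrite lerXn2r// nnegrE ltW// (lt_le_trans t0 tn).
have L0 : 0 < ln r ^+ 2 by have := exprn_gt0 2 t0; lra.
have : (4 * ln r ^+ 2 * m')^-1 <= v n.
  have Lm : 0 < 4 * ln r ^+ 2 * m' by rewrite mulr_gt0// mulr_gt0.
  have nm : 0 < n.+1%:R ^+ 2 * m n by rewrite mulr_gt0// exprn_gt0.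
  rewrite lef_pV2 ?posrE//.
  by apply: ler_pM; rewrite ?(ltW m0) ?sqr_ge0//.
have -> : (8 * ln r ^+ 2 * m')^-1 = (4 * ln r ^+ 2 * m')^-1 / 2.
  by field; rewrite gt_eqF//= -sqrf_eq0 gt_eqF.
by move=> H; move: vk; set u := (4 * _ * _)^-1 in H *; lra.
Qed.

Lemma minkowski_le_cover_exponent : mu X = 1%E -> invariant_measure X f mu ->
  (upper_minkowski_dim mu < +oo)%E ->
  {ae mu, forall x, X x ->
    (upper_minkowski_dim mu <= upper_cover_exponent X f x)%E /\
    (lower_minkowski_dim mu <= lower_cover_exponent X f x)%E}.
Proof.
move=> muX inv fin; have [supp0|supp0] := pselect (measure_support mu !=set0).
  apply: aeS (cover_time_ge muX inv supp0 fin) => x Hx Xx.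
  by apply: (cover_exponent_ge supp0 fin _ _ (Hx Xx)).
(* For an empty support [M r] is an infimum over the empty set, [+oo], and the dimension quotients
   are [-oo]. *)
apply/aeW => x _; apply: (limf_right_le ltr01) => e e0.
apply/near0_rightP; exists 1 => // r /andP[r0 r1].
rewrite mul1r /min_ball_measure.
have -> : measure_support mu = set0 by apply/eqP/negPn/negP => /set0P.
have lr0 : ln r < 0 by rewrite ln_lt0// r0.
by rewrite image_set0 ereal_inf0 /= inver lt_eqF// lt0_mulye ?leNye// lte_fin
  invr_lt0.
Qed.
End lower_bounds.

(** * Symbolic coding *)

Section sequence_space.
Context {A : pointedType}.
Hypothesis countableA : countable [set: A].

Lemma seq_code : exists code : seq A -> nat, injective code.
Proof.
have /countable_injP[c cinj] := countableA.
exists (fun i => pickle (map c i)) => i j /(pcan_inj (@pickleK _)).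
by apply: inj_map => a b; apply: cinj; rewrite inE.
Qed.

Lemma countable_words : countable [set: seq A].
Proof.
by have [c cinj] := seq_code; apply/countable_injP; exists c => i j _ _ /cinj.
Qed.

(** There are countably many prefixes, and on each class of sequences sharing a prefix the condition
    is a fixed measurable one. *)
Lemma measurable_prefix_cases n (E : seq A -> set (sequences A)) :
  (forall i, measurable (E i)) ->
  measurable [set w : sequences A | E (mkseq w n) w].
Proof.
move=> mE.
have -> : [set w : sequences A | E (mkseq w n) w] =
          \bigcup_i ([set w : sequences A | mkseq w n = i] `&` E i).
  by apply/seteqP; split=> [w Ew|w [i _ [/= <-]]//]; exists (mkseq w n).
apply: countable_bigcupT_measurable; first exact: countable_words.
move=> i; apply: measurableI => //.
have [ni|/eqP ni] := pselect (size i = n); last first.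
  rewrite (_ : [set _ | _] = set0)//; apply/seteqP; split=> // w /= wi.
  by move: ni; rewrite -wi size_mkseq eqxx.
rewrite (_ : [set _ | _] = \bigcap_(k in `I_n) [set w : sequences A | w k = nth
  point i k]).
  apply: bigcap_measurableType => k _.
  by apply: sub_sigma_algebra; exists k, (nth point i k).
apply/seteqP; split=> w /=.
  by move=> <- k /= kn; rewrite nth_mkseq.
move=> wi; apply: (@eq_from_nth _ point); rewrite size_mkseq//.
by move=> k kn; rewrite nth_mkseq//; exact: wi.
Qed.

Lemma measurable_prefix n (D : set (seq A)) :
  measurable [set w : sequences A | D (mkseq w n)].
Proof.
apply: (@measurable_prefix_cases n (fun i => [set _ | D i])) => i.
have [Di|Di] := pselect (D i).
  by rewrite (_ : [set _ | _] = setT)//; apply/seteqP; split.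
by rewrite (_ : [set _ | _] = set0)//; apply/seteqP; split.
Qed.

Lemma measurable_fun_prefix n d (T : measurableType d) (g : seq A -> T) :
  measurable_fun setT (fun w : sequences A => g (mkseq w n)).
Proof.
move=> _ B mB; rewrite setTI.
exact: (@measurable_prefix n (g @^-1` B)).
Qed.

Lemma measurable_shift :
  measurable_fun setT (Defs.shift : sequences A -> sequences A).
Proof.
apply: (@measurability _ _ (sequences A) (sequences A) setT Defs.shift
  (@coordinate_sets A)) => // _ [_ [n [a ->]] <-].
by rewrite setTI; apply: sub_sigma_algebra; exists n.+1, a.
Qed.

Lemma measurable_iter_shift N (B : set (sequences A)) :
  measurable B -> measurable (iter N Defs.shift @^-1` B : set (sequences A)).
Proof.
elim: N B => [//|N IH] B mB.
have := IH _ (measurable_shift measurableT mB); rewrite setTI.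
by congr measurable; apply/seteqP; split.
Qed.

Lemma iter_shiftE N (w : nat -> A) k : iter N Defs.shift w k = w (N + k)%N.
Proof. by elim: N k => //= N IH k; rewrite /Defs.shift IH addnS. Qed.

End sequence_space.

(** * Word intervals and measurability of the coding map *)

Section coding.
Context {R : realType} {A : pointedType} {P : A -> set R} {X : set R}
  {f : R -> R}.
Hypothesis countableA : countable [set: A].
Hypothesis markov_f : piecewise_expanding_markov P X f.

Lemma measurable_shift_space : measurable (shift_space P f : set (sequences A)).
Proof.
rewrite (_ : shift_space P f = \bigcap_k [set w : sequences A |
  [set i | transition_matrix P f (nth point i k) (nth point i k.+1) = 1%E]
    (mkseq w k.+2)]).
  by apply: bigcap_measurable => // k _; exact: measurable_prefix.
apply/seteqP; split=> w wP k.
  by move=> _; rewrite /mkset !nth_mkseq//; exact: wP.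
by have := wP k I; rewrite /mkset !nth_mkseq.
Qed.

Definition word_interval (i : seq A) : set R :=
  [set x | X x /\ forall k, (k < size i)%N -> P (nth point i k) (iter k f x)].

Lemma word_interval_prefix (w : nat -> A) n x : word_interval (mkseq w n) x <->
  X x /\ forall k, (k < n)%N -> P (w k) (iter k f x).
Proof.
split=> -[Xx wx]; split=> // k; have := wx k; rewrite size_mkseq => + kn.
  by rewrite nth_mkseq// => /(_ kn).
by rewrite nth_mkseq// => /(_ kn).
Qed.

Lemma measurable_word_interval i :
  measurable (word_interval i : set (measurableTypeR R)).
Proof.
rewrite (_ : word_interval i = X `&` \bigcap_(k in `I_(size i))
    (X `&` iter k f @^-1` P (nth point i k))); last first.
  apply/seteqP; split=> x [Xx ix]; split=> // k ki; last by have [] := ix k ki.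
  by split=> //; exact: ix.
apply: measurableI; first exact: (markov_measurable countableA markov_f).
apply: bigcap_measurableType => k _.
apply: (markov_measurable_iter countableA markov_f).
exact: (markov_measurable_piece markov_f).
Qed.

Lemma coded_word_interval (w : nat -> A) x n :
  coded_points P f w x -> word_interval (mkseq w n) x.
Proof.
move=> wx; apply/word_interval_prefix; split=> [|k _]; last exact: wx.
case: markov_f => -[_ _ ->] _ _ _; exists (w 0); first by [].
exact: (wx 0).
Qed.

Lemma word_interval_dist : exists2 gamma : R, 1 < gamma &
  forall (w : nat -> A) n x y, word_interval (mkseq w n.+1) x ->
    word_interval (mkseq w n.+1) y -> `|x - y| <= gamma ^- n.
Proof.
have [g g1 gP] := itinerary_dist markov_f; exists g => // w n x y.
move=> /word_interval_prefix[_ wx] /word_interval_prefix[_ wy].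
by apply: (gP w) => k kn; [exact: wx|exact: wy].
Qed.

(** Depends on a finite prefix only, hence is measurable in [w]; it converges to the coded point
    whenever there is one. *)
Let sample n (w : nat -> A) : R := xget 0 (word_interval (mkseq w n.+1)).

Let sample_cvg (w : nat -> A) x : coded_points P f w x ->
  sample n w @[n --> \oo] --> x.
Proof.
move=> wx; have [g g1 gP] := word_interval_dist.
have g0 : 0 < g by apply: lt_trans g1.
have : (g^-1) ^+ n @[n --> \oo] --> (0 : R).
  by apply: cvg_expr; rewrite ger0_norm ?invr_ge0 1?ltW// invf_lt1.
move=> /cvgrPdist_lt gn; apply/cvgrPdist_lt => e e0.
apply: filterS (gn e e0) => n; rewrite sub0r normrN => ge.
apply: le_lt_trans ge; rewrite (le_trans _ (ler_norm _))// exprVn.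
apply: (gP w n); first exact: coded_word_interval.
by apply: xgetPex; exists x; exact: coded_word_interval.
Qed.

Let limit (w : nat -> A) : \bar R := limn_esup (fun n => (sample n w)%:E).

Let limitE (w : nat -> A) x : coded_points P f w x -> limit w = x%:E.
Proof.
move=> wx; apply: (cvg_limn_einf_sup _).2.
by apply/cvg_EFin; [exact: nearW|exact: sample_cvg].
Qed.

(** Every point coded by [w] is the limit of the same samples, so it is unique. *)
Lemma coding_mapE (w : nat -> A) x :
  coded_points P f w x -> coding_map P f w = x.
Proof.
move=> wx; apply: xget_unique => // y wy.
by apply: EFin_inj; rewrite -(limitE wx) -(limitE wy).
Qed.

Let measurable_limit : measurable_fun setT (limit : sequences A -> \bar R).
Proof.
apply: measurable_fun_limn_esup => n.
exact: (@measurable_fun_prefix _ countableA n.+1 _ _ (fun i => (xget 0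
  (word_interval i))%:E)).
Qed.

(* A sequence codes a point iff the limit of points sampled in its word
   intervals exists and lies in all of them; the superior limit spares the
   discussion of convergence. *)
Lemma measurable_coding_map :
  measurable_fun setT (coding_map P f : sequences A -> measurableTypeR R).
Proof.
pose G := \bigcap_n [set w : sequences A |
  (limit @^-1` (EFin @` word_interval (mkseq w n))) w].
have mG : measurable (G : set (sequences A)).
  apply: bigcap_measurable => // n _.
  apply: (@measurable_prefix_cases _ countableA n
    (fun i => limit @^-1` (EFin @` word_interval i))) => i.
  rewrite -[X in measurable X]setTI; apply: measurable_limit => //.
  by apply: measurable_image_EFin; exact: measurable_word_interval.
(* Off [G] no point is coded, and [xget] returns its default 0. *)
have codingE w : coding_map P f w = if `[< G w >] then fine (limit w) else 0.
  case: asboolP => Gw.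
    have Gx n : exists2 x, word_interval (mkseq w n) x & x%:E = limit w by
      exact: Gw.
    have [x0 _ x0E] := Gx 0; rewrite -x0E /=; apply: coding_mapE => k _.
    have [x /word_interval_prefix[_ wx]] := Gx k.+1.
    by rewrite -x0E => -[<-]; exact: wx.
  apply: xgetPN => x wx; apply: Gw => n _; exists x;
    last by rewrite (limitE wx).
  exact: coded_word_interval.
move=> _ B mB; rewrite setTI.
have -> : coding_map P f @^-1` B = (G `&` (fine \o limit) @^-1` B) `|`
                                   (~` G `&` [set _ | B 0]).
  apply/seteqP; split=> w /=; rewrite codingE; case: asboolP => Gw.
  - by left.
  - by right.
  - by case=> -[].
  - by case=> -[].
apply: measurableU; apply: measurableI => //.
- rewrite -[X in measurable X]setTI; apply: measurableT_comp => //.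
- exact: measurableC.
- have [B0|B0] := pselect (B 0).
    by rewrite (_ : [set _ | _] = setT)//; apply/seteqP; split.
  by rewrite (_ : [set _ | _] = set0)//; apply/seteqP; split.
Qed.

End coding.

(** * Mixing *)

Section mixing.
Context {R : realType} {A : pointedType} {P : A -> set R} {X : set R}
  {f : R -> R} {mut : probability (sequences A) R}.
Hypothesis countableA : countable [set: A].
Local Notation Sigma := (shift_space P f : set (sequences A)).
Local Notation sigma N := (iter N Defs.shift).

(** The union of the cylinders of length [n] over the words in [D]. *)
Definition prefix_event n (D : set (seq A)) : set (sequences A) :=
  [set w | Sigma w /\ D (mkseq w n)].

Lemma measurable_prefix_event n D : measurable (prefix_event n D).
Proof.
apply: measurableI; first exact: measurable_shift_space.
exact: measurable_prefix.
Qed.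

Lemma cylinderE i : cylinder P f i = prefix_event (size i) [set i].
Proof. by []. Qed.

Lemma shift_space_prefix (w : nat -> A) n : (0 < n)%N -> Sigma w ->
  admissible_word P f (mkseq w n).
Proof.
case: n => // n _ wS; rewrite /admissible_word /=.
suff step k : path (fun a b => transition_matrix P f a b == 1%E) (w k)
    [seq w j | j <- iota k.+1 n] by exact: (step 0%N).
by elim: n k => //= n IH k; rewrite IH andbT; apply/eqP; exact: wS.
Qed.

(** Countable additivity: cylinders of equal length are disjoint, so an inequality linear in the
    measure of a cylinder extends to their unions. *)
Lemma sum_cylinders_le (c : R) (B : set (sequences A)) N n D :
  0 <= c -> measurable B -> (0 < n)%N ->
  (forall i, admissible_word P f i -> size i = n ->
    (c%:E * mut (cylinder P f i) <= mut (B `&` sigma N @^-1` cylinder P f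
      i))%E) ->
  (c%:E * mut (prefix_event n D) <= mut (B `&` sigma N @^-1` prefix_event n
    D))%E.
Proof.
move=> c0 mB n0 cB; have [code codeI] := seq_code countableA.
(* By injectivity of [code], each [E k] is a single cylinder or empty. *)
pose E k := prefix_event n [set i | D i /\ code i = k].
have mE k : measurable (E k) by exact: measurable_prefix_event.
have -> : prefix_event n D = \bigcup_k E k.
  apply/seteqP; split=> w; last by case=> k _ [Sw [Dw _]].
  by move=> [Sw Dw]; exists (code (mkseq w n)).
have tE : trivIset setT E.
  apply/trivIsetP => k l _ _ kl; apply/seteqP;
    split=> // w [[_ [_ wk]] [_ [_ wl]]].
  by move: kl; rewrite -wk -wl eqxx.
rewrite preimage_bigcup setI_bigcupr !measure_semi_bigcup//.
- rewrite -nneseriesZl//; apply: lee_nneseries => k _.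
    by rewrite mule_ge0.
  have [[w [Sw [Dw wk]]]|E0] := pselect (E k !=set0).
    have -> : E k = cylinder P f (mkseq w n).
      rewrite cylinderE size_mkseq; apply/seteqP; split=> v [Sv].
        by case=> _ vk; split => //; apply: codeI; rewrite vk.
      by move=> vw; split=> //; rewrite vw.
    by apply: cB; rewrite ?size_mkseq//; exact: shift_space_prefix.
  rewrite (_ : E k = set0); last by apply/eqP/negPn/negP => /set0P.
  by rewrite measure0 mule0.
- by move=> k; apply: measurableI => //; exact: measurable_iter_shift.
- apply/trivIsetP => k l _ _ kl; apply/seteqP; split=> // w [[_ Ek] [_ El]].
  have : (E k `&` E l) (sigma N w) by split.
  by move/trivIsetP : tE => ->.
- apply: bigcupT_measurable => k; apply: measurableI => //;
    exact: measurable_iter_shift.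
- exact: bigcupT_measurable.
Qed.


Variable q : nat.
Hypothesis mix : forall i j, admissible_word P f i -> admissible_word P f j ->
  ((2^-1 : R)%:E * mut (cylinder P f i) * mut (cylinder P f j) <=
   mut (cylinder P f i `&` sigma (size i + q) @^-1` cylinder P f j))%E.

Let mut_fin (B : set (sequences A)) : measurable B -> (fine (mut B))%:E = mut B.
Proof. by move=> mB; rewrite fineK// fin_num_measure. Qed.

Lemma prefix_events_mix n D n' D' : (0 < n)%N -> (0 < n')%N ->
  ((2^-1 : R)%:E * mut (prefix_event n' D') * mut (prefix_event n D) <=
   mut (prefix_event n D `&` sigma (n + q) @^-1` prefix_event n' D'))%E.
Proof.
move=> n0 n'0; have mV := measurable_prefix_event n' D'.
rewrite -(mut_fin mV) -EFinM setIC.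
(* Summation over the first words, with the second event fixed; the second application, below, sums
   over the second words. *)
apply: (@sum_cylinders_le _ _ 0%N) => //.
- by rewrite mulr_ge0// fine_ge0.
- exact: measurable_iter_shift.
move=> i ai ni; rewrite EFinM (mut_fin mV) setIC /=.
have mi : measurable (cylinder P f i : set (sequences A)).
  by rewrite cylinderE; exact: measurable_prefix_event.
rewrite muleAC -(mut_fin mi) -EFinM.
apply: sum_cylinders_le => //.
- by rewrite mulr_ge0// fine_ge0.
move=> j aj _; rewrite EFinM (mut_fin mi) -ni.
exact: mix.
Qed.

(* [avoids n D T]: none of the windows [t (n + q), t (n + q) + n), t <= T, of
   the sequence carries a word of [D]; consecutive windows are [q] apart. *)
Definition avoids n (D : set (seq A)) T : set (sequences A) :=
  [set w | Sigma w /\ forall t, (t <= T)%N ->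
     ~ D (mkseq (sigma (t * (n + q)) w) n)].

Lemma mkseq_iter_shift (w : nat -> A) N n L : (N + n <= L)%N ->
  mkseq (sigma N w) n = take n (drop N (mkseq w L)).
Proof.
move=> NnL; apply: (@eq_from_nth _ point).
  by rewrite size_mkseq size_takel// size_drop size_mkseq leq_subRL//
    (leq_trans _ NnL)// leq_addr.
move=> k; rewrite size_mkseq => kn.
rewrite nth_mkseq// nth_take// nth_drop nth_mkseq ?iter_shiftE//.
by rewrite (leq_trans _ NnL)// ltn_add2l.
Qed.

(** The prefix ends with the last window, so avoidance can be the first event in
    [prefix_events_mix]. *)
Lemma avoidsE n D T : avoids n D T = prefix_event (T * (n + q) + n)
  [set i | forall t, (t <= T)%N -> ~ D (take n (drop (t * (n + q)) i))].
Proof.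
have tT t : (t <= T)%N -> (t * (n + q) + n <= T * (n + q) + n)%N.
  by move=> tT; rewrite leq_add2r leq_mul2r tT orbT.
by apply/seteqP; split=> w [Sw Dw]; split=> // t /[dup] /tT tT' /Dw;
  rewrite (mkseq_iter_shift _ tT').
Qed.

Lemma shift_space_iter (w : nat -> A) N : Sigma w -> Sigma (sigma N w).
Proof. by move=> Sw k; rewrite !iter_shiftE addnS; exact: Sw. Qed.

(** Induction on [T]: by mixing, at least the proportion [u / 2] of the sequences avoiding [D] so
    far carry a word of [D] in the next window. The window at time 0 is only bounded by 1, hence the
    exponent [T] for [T + 1] windows. *)
Lemma avoids_decay n D T : (0 < n)%N ->
  (mut (avoids n D T) <=
   ((1 - fine (mut (prefix_event n D)) / 2) ^+ T)%:E)%E.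
Proof.
move=> n0; have mU := measurable_prefix_event n D.
have mA t : measurable (avoids n D t).
  by rewrite avoidsE; exact: measurable_prefix_event.
have u1 : fine (mut (prefix_event n D)) <= 1.
  by rewrite -lee_fin (mut_fin mU) probability_le1.
elim: T => [|T IH]; first by rewrite expr0 probability_le1.
pose V := sigma (T.+1 * (n + q)) @^-1` prefix_event n D.
have mV : measurable (V : set (sequences A)) by exact: measurable_iter_shift.
have -> : avoids n D T.+1 = avoids n D T `\` V.
  apply/seteqP; split=> w.
    move=> [Sw Dw]; split; first by split=> // t tT; apply: Dw; exact: leqW.
    by move=> [_]; exact: Dw.
  move=> [[Sw Dw] nV]; split=> // t; rewrite leq_eqVlt ltnS =>
    /orP[/eqP->|/Dw//].
  by move=> DT; apply: nV; split=> //; exact: shift_space_iter.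
have := prefix_events_mix (n := T * (n + q) + n)
  [set i | forall t, (t <= T)%N -> ~ D (take n (drop (t * (n + q)) i))] D _ n0.
rewrite addn_gt0 n0 orbT => /(_ isT).
(* The gap [q] after the prefix leads exactly to the start of the next window. *)
rewrite -avoidsE (_ : T * (n + q) + n + q = T.+1 * (n + q))%N;
  last by rewrite mulSn; ring.
have mD : mut (avoids n D T `\` V) =
    (mut (avoids n D T) - mut (avoids n D T `&` V))%E.
  by apply: measureD => //; rewrite ltey_eq fin_num_measure.
rewrite -/V mD => H.
move: H IH.
have := esym (mut_fin (measurableI _ _ (mA T) mV)).
have := esym (mut_fin (mA T)); have := esym (mut_fin mU); move: u1.
move: (fine _) => u u1; move: (fine _) => a; move: (fine _) => v -> -> ->.
rewrite -EFinB -!EFinM !lee_fin exprS; move: (_ ^+ T) => b uv ab.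
have : a * (1 - u / 2) <= b * (1 - u / 2) by rewrite ler_wpM2r//; lra.
lra.
Qed.

End mixing.

(** * Upper estimate *)

Section upper_bounds.
Context {R : realType} {A : pointedType} {P : A -> set R} {X : set R}
  {f : R -> R} {mu : probability (measurableTypeR R) R}.
Hypothesis countableA : countable [set: A].
Hypothesis markov_f : piecewise_expanding_markov P X f.
Local Notation M := (min_ball_measure mu).
Local Notation J := (@word_interval R A P X f).
Local Notation event := (@prefix_event R A P f).
Local Notation sigma N := (iter N Defs.shift).

Lemma psi_mixing_half : exponentially_psi_mixing P f mu ->
  exists2 mut : probability (sequences A) R, symbolic_measure P f mu mut &
  exists q, forall i j, admissible_word P f i -> admissible_word P f j ->
    [/\ (0 < mut (cylinder P f i))%E &
    ((2^-1 : R)%:E * mut (cylinder P f i) * mut (cylinder P f j) <=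
     mut (cylinder P f i `&` sigma (size i + q) @^-1` cylinder P f j))%E].
Proof.
move=> [mut smut [C1 [rho [psi [C10 rho0 _ psiC mix]]]]]; exists mut => //.
(* Chosen so that [expR (rho q) >= 1 + rho q >= 2 C1], whence [psi q <= 1 / 2]. *)
pose q := (Num.truncn (2 * C1 / rho)).+1; exists q => i j ai aj.
have psiq : psi q <= 1 / 2.
  apply: le_trans (psiC q isT) _; rewrite mulNr expRN -ler_pdivlMl//
    -[leRHS]invrK.
  rewrite lef_pV2 ?posrE ?expR_gt0 ?invr_gt0 ?mulr_gt0 ?invr_gt0//.
  rewrite (le_trans _ (expR_ge1Dx _))// -[leLHS]add0r lerD//.
  have -> : (C1^-1 * (1 / 2))^-1 = rho * (2 * C1 / rho) by field;
    rewrite !gt_eqF.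
  by rewrite ler_pM2l// ltW// truncnS_gt.
have mc l : measurable (cylinder P f l : set (sequences A)).
  by rewrite cylinderE; exact: measurable_prefix_event.
have mcc : measurable (cylinder P f i `&` sigma (size i + q) @^-1` cylinder P f
  j
    : set (sequences A)).
  by apply: measurableI => //; exact: measurable_iter_shift.
have finE (B : set (sequences A)) : measurable B -> mut B = (fine (mut B))%:E.
  by move=> mB; rewrite fineK// fin_num_measure.
have := le_trans (mix i j q ai aj isT) psiq.
have ge0 B : 0 <= fine (mut B) by exact: fine_ge0.
move: (ge0 (cylinder P f i)) (ge0 (cylinder P f j)).
have := finE _ (mc i); have := finE _ (mc j); have := finE _ mcc.
move: (fine (mut (cylinder P f i))) => y; move: (fine (mut (cylinder P f j)))
  => z.
move: (fine _) => x -> -> ->; rewrite -!EFinM lte_fin lee_fin => y0 z0.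
(* A null cylinder would make the quotient 0 by convention, at distance 1 from 1, which exceeds
   [1 / 2]. *)
have [yz|yz] := eqVneq (y * z) 0.
  by rewrite yz invr0 mulr0 sub0r normrN normr1; lra.
have yz0 : 0 < y * z by rewrite lt_neqAle eq_sym yz mulr_ge0.
rewrite ler_distl => /andP[+ _]; rewrite ler_pdivlMr// => xyz; split.
  by rewrite lt_neqAle y0 andbT eq_sym; apply: contraNneq yz => ->;
    rewrite mul0r.
by move: xyz; rewrite -mulrA; lra.
Qed.

Section symbolic_bounds.
Variables (mut : probability (sequences A) R) (q : nat).
Hypothesis smut : symbolic_measure P f mu mut.
Hypothesis mix : forall i j, admissible_word P f i -> admissible_word P f j ->
  [/\ (0 < mut (cylinder P f i))%E &
    ((2^-1 : R)%:E * mut (cylinder P f i) * mut (cylinder P f j) <=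
     mut (cylinder P f i `&` sigma (size i + q) @^-1` cylinder P f j))%E].

Let measurable_coding (B : set (measurableTypeR R)) : measurable B ->
  measurable (coding_map P f @^-1` B : set (sequences A)).
Proof.
by move=> mB; rewrite -[X in measurable X]setTI;
  exact: (measurable_coding_map countableA markov_f).
Qed.

(** A long enough word of an itinerary of [x] has its word interval inside [U], and its cylinder has
    positive measure. Hence balls centred in [X] have measure at least [M]. *)
Lemma support_repeller : X `<=` measure_support mu.
Proof.
move=> x Xx U oU Ux; have [w wx] := markov_itinerary markov_f Xx.
have [g g1 gP] := word_interval_dist markov_f.
have g0 : 0 < g by apply: lt_trans g1.
have [e /= e0 eU] := (nbhs_ballP _ _).1 (open_nbhs_nbhs (conj oU Ux)).
have : (g^-1) ^+ n @[n --> \oo] --> (0 : R).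
  by apply: cvg_expr; rewrite ger0_norm ?invr_ge0 1?ltW// invf_lt1.
move=> /cvgrPdist_lt/(_ e e0)[n _ /(_ n (leqnn n))] /=.
rewrite sub0r normrN exprVn ger0_norm ?invr_ge0 ?exprn_ge0 1?ltW// => gn.
have mJ := measurable_word_interval countableA markov_f (mkseq w n.+1).
have mU : measurable (U : set (measurableTypeR R)) by exact: open_measurable.
apply: (@lt_le_trans _ _ (mu (J (mkseq w n.+1)))); last first.
  apply: le_measure; rewrite ?inE// => y Jy; apply: eU.
  by apply: le_lt_trans gn; apply: (gP w) => //; exact: coded_word_interval.
have adm := shift_space_prefix (ltn0Sn n) (itinerary_admissible wx).
have [c0 _] := mix adm adm; apply: (lt_le_trans c0).
case: smut => ae_coded push; rewrite -(push _ mJ) /pushforward.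
apply: ae_le_measure ae_coded _.
- by rewrite cylinderE; exact: measurable_prefix_event.
- exact: measurable_coding.
move=> v [_ cv] [_]; rewrite size_mkseq => <-.
exact: (coded_word_interval markov_f).
Qed.

(** A word interval of diameter below [rho] that meets the ball of radius [rho] lies in the one of
    radius [2 rho]. *)
Lemma ball_word_event (y rho : R) n :
  (forall (w : nat -> A) x z, J (mkseq w n.+1) x ->
     J (mkseq w n.+1) z -> `|x - z| < rho) ->
  (mu (ball y rho) <= mut (event n.+1
     [set i | J i `<=` ball y (2 * rho)%R]))%E.
Proof.
move=> diam; case: smut => ae_coded push; have mB := measurable_ballR y rho.
rewrite -(push _ mB) /pushforward; apply: ae_le_measure ae_coded _.
- exact: measurable_coding.
- exact: measurable_prefix_event.
move=> w [Sw cw] yw; split => // x wx.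
have -> : 2 * rho = rho + rho by rewrite mulr_natl mulr2n.
apply: (ball_triangle yw); apply: (diam w); last exact: wx.
exact: (coded_word_interval markov_f).
Qed.

Definition misses (B : set R) K : set R :=
  [set x | X x /\ forall j, (j <= K)%N -> ~ B (iter j f x)].

Lemma measurable_misses (B : set (measurableTypeR R)) K : measurable B ->
  measurable (misses B K : set (measurableTypeR R)).
Proof.
move=> mB; rewrite (_ : misses B K = X `&` \bigcap_(j in [set j | (j <= K)%N])
    (X `&` iter j f @^-1` (~` B))); last first.
  apply/seteqP; split=> x [Xx xB]; split=> // j jK; last by have [] := xB j jK.
  by split=> //; exact: xB.
apply: measurableI; first exact: (markov_measurable countableA markov_f).
apply: bigcap_measurableType => j _.
by apply: (markov_measurable_iter countableA markov_f); exact: measurableC.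
Qed.


Lemma iter_codedE (w : nat -> A) x N :
  coded_points P f w x -> coded_points P f (sigma N w) (iter N f x).
Proof. by move=> wx k _; rewrite iter_shiftE /preimage/= -iterD addnC;
  exact: wx. Qed.

(** A coding of a point whose orbit misses the ball carries, in all [T + 1] windows, no word whose
    interval lies in the ball; such words have total measure at least [m], and [avoids_decay]
    applies. *)
Lemma misses_ball_measure (y rho m : R) n T :
  (forall (w : nat -> A) x z, J (mkseq w n.+1) x ->
     J (mkseq w n.+1) z -> `|x - z| < rho) ->
  (m%:E <= mu (ball y rho))%E ->
  (mu (misses (ball y (2 * rho)%R) (T * (n.+1 + q))) <= ((1 - m / 2) ^+
    T)%:E)%E.
Proof.
move=> diam mB; pose D := [set i | J i `<=` ball y (2 * rho)].
have mU : measurable (event n.+1 D) by exact: measurable_prefix_event.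
pose u := fine (mut (event n.+1 D)).
have uE : u%:E = mut (event n.+1 D) by rewrite fineK// fin_num_measure.
have mu_u : m <= u.
  by rewrite -lee_fin uE (le_trans mB)//; exact: ball_word_event.
have u1 : u <= 1 by rewrite -lee_fin uE probability_le1.
have mM : measurable (misses (ball y (2 * rho)) (T * (n.+1 + q)) : set
  (measurableTypeR R)).
  by apply: measurable_misses; exact: measurable_ballR.
apply: (@le_trans _ _ (mut (avoids q (P := P) (f := f) n.+1 D T))).
  case: smut => ae_coded push; rewrite -(push _ mM) /pushforward.
  apply: ae_le_measure ae_coded _; first exact: measurable_coding.
    by rewrite avoidsE; exact: measurable_prefix_event.
  move=> w [Sw cw] [_ nB]; split=> // t tT Dt.
  apply: (nB (t * (n.+1 + q))%N); first by rewrite leq_mul2r tT orbT.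
  by apply: Dt; apply: (coded_word_interval markov_f); exact: iter_codedE.
have mix' i j ai aj := (mix (i := i) (j := j) ai aj).2.
apply: le_trans (avoids_decay countableA mix' _ _ (ltn0Sn n)) _.
rewrite -/u lee_fin lerXn2r// ?nnegrE; lra.
Qed.


Lemma cover_at_scale : exists2 C : R, 0 < C &
  forall k (m : R), 0 < m -> m <= 1 -> M (2 ^- k.+2) = m%:E ->
  exists (F : set (measurableTypeR R)) (K : nat),
    [/\ measurable F, (mu F <= (2 * k.+1%:R ^- 2)%:E)%E,
        K%:R <= C * k.+1%:R ^+ 2 / m &
        forall x, X x -> ~ F x -> forall y, X y ->
          exists2 j, (j <= K)%N & `|iter j f x - y| < 2 ^- k].
Proof.
have [g g1 gP] := word_interval_dist markov_f.
have g0 : 0 < g by apply: lt_trans g1.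
have [a ga] : exists a, g ^- a < 2^-1.
  have : (g^-1) ^+ n @[n --> \oo] --> (0 : R).
    by apply: cvg_expr; rewrite ger0_norm ?invr_ge0 1?ltW// invf_lt1.
  move=> /cvgrPdist_lt/(_ 2^-1)[//|a _ /(_ a (leqnn a))] /=.
  by rewrite sub0r normrN exprVn ger0_norm ?invr_ge0 ?exprn_ge0 1?ltW//;
    exists a.
(* With [x = k + 1], [K] is the product of [T <= 7 x / m] and [n + 1 + q <= (2 a + 1 + q) x]. *)
exists (7 * (2 * a%:R + 1 + q%:R)); first by rewrite mulr_gt0// -!natrM -!natrD
  ltr0n addn1.
move=> k m m0 m1 Mm; set x : R := k.+1%:R.
have x1 : 1 <= x by rewrite ler1n.
(* [n] makes word intervals shorter than [2 ^- k.+2]. [T] gives [(1 - m / 2)^T <= expR (- 3 x)];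
   summed over at most [2 expR x] balls this leaves [2 expR (- 2 x) <= 2 / x^2]. The extra cell in
   [N] accounts for the point 1. *)
pose n := (a * k.+2)%N; pose T := (Num.truncn (6 * x / m)).+1.
pose K := (T * (n.+1 + q))%N; pose N := (2 ^ k.+1).+1.
have diam (w : nat -> A) y z : J (mkseq w n.+1) y -> J (mkseq w n.+1) z ->
    `|y - z| < 2 ^- k.+2.
  move=> wy wz; apply: le_lt_trans (gP _ _ _ _ wy wz) _.
  rewrite -!exprVn exprM ltrXn2r ?nnegrE ?exprn_ge0 ?invr_ge0 ?(ltW g0)//.
  by rewrite exprVn.
pose cell (y : R) := Num.truncn (y * 2 ^+ k.+1).
(* One centre in [X] per cell that meets [X]; the other cells receive any point of [X], so the
   measure bound holds for every index. *)
have /choice[c cP] : forall j, exists c, X c /\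
    ((exists2 y, X y & cell y = j) -> cell c = j).
  move=> j; have [[b Xb bj]|nex] := pselect (exists2 y, X y & cell y = j).
    by exists b.
  have [b [_ [Xb _ _]]] := markov_two_points markov_f; exists b.
  by split=> // -[z Xz zj]; case: nex; exists z.
pose F j : set (measurableTypeR R) := misses (ball (c j) (2 * 2 ^- k.+2)) K.
have mF j : measurable (F j) by apply: measurable_misses;
  exact: measurable_ballR.
have muF j : (mu (F j) <= ((1 - m / 2) ^+ T)%:E)%E.
  apply: misses_ball_measure; first exact: diam.
  rewrite -Mm.
  by apply: ereal_inf_lbound; exists (c j) => //; apply: support_repeller;
    have [] := cP j.
have mT : 6 * x <= m * T%:R.
  by rewrite [leRHS]mulrC -ler_pdivrMr// ltW// truncnS_gt.
exists (\big[setU/set0]_(j < N) F j), K; split.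
- by apply: bigsetU_measurable => j _; exact: mF.
- apply: le_trans (Boole_inequality mu (fun j _ => mF j)) _.
  apply: (@le_trans _ _ (\sum_(j < N) ((1 - m / 2) ^+ T)%:E)%E).
    by apply: lee_sum => j _; exact: muF.
  rewrite sumEFin lee_fin sumr_const card_ord -[_ *+ N]mulr_natl.
  have e1 : 2 <= expR 1 :> R by have := expR_ge1Dx (1 : R).
  have eN : N%:R <= 2 * expR x.
    rewrite /x -[k.+1%:R]mulr1 expRM_natl.
    apply: (@le_trans _ _ (2 * 2 ^+ k.+1)); last first.
      by rewrite ler_pM2l// lerXn2r ?nnegrE ?expR_ge0.
    by rewrite -natrX -natrM ler_nat /N mul2n -addnn -addn1 leq_add2l expn_gt0.
  have eT : (1 - m / 2) ^+ T <= expR (- x) ^+ 3.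
    apply: (@le_trans _ _ (expR (- (m / 2)) ^+ T)).
      by rewrite lerXn2r// ?nnegrE ?expR_ge0//; [lra|exact: expR_ge1Dx].
    by rewrite -!expRM_natl ler_expR; lra.
  apply: (@le_trans _ _ (2 * expR x * expR (- x) ^+ 3)).
    by rewrite ler_pM// exprn_ge0//; lra.
  rewrite exprS mulrA -(mulrA 2) -expRD subrr expR0 mulr1 ler_pM2l//.
  rewrite expRN exprVn lef_pV2 ?posrE ?exprn_gt0 ?expR_gt0 ?(lt_le_trans _
    x1)//.
  rewrite lerXn2r ?nnegrE ?expR_ge0 ?(le_trans _ x1)//.
  by rewrite (le_trans _ (expR_ge1Dx _))// lerDr.
- rewrite /K natrM.
  have T7 : T%:R <= 7 * x / m.
    rewrite ler_pdivlMr// /T -natr1 mulrDl mul1r.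
    have : (Num.truncn (6 * x / m))%:R * m <= 6 * x.
      by rewrite -ler_pdivlMr// truncn_le divr_ge0// ?(ltW m0)// mulr_ge0//;
        lra.
    lra.
  have nx : (n.+1 + q)%:R <= (2 * a%:R + 1 + q%:R) * x.
    rewrite natrD -natr1 /n natrM -(natr1 k.+1) -/x.
    have a0 : 0 <= a%:R :> R by [].
    have q0 : 0 <= q%:R :> R by [].
    nra.
  rewrite (le_trans (ler_pM _ _ T7 nx))//.
  by rewrite le_eqVlt; apply/orP; left; apply/eqP; ring.
- move=> y Xy nF z Xz; have cz : cell (c (cell z)) = cell z by apply: (cP _).2;
    exists z.
  have zN : (cell z < N)%N.
    have /andP[z0 z1] := markov_unit markov_f Xz.
    rewrite ltnS -(ler_nat R) (le_trans (_ : _ <= z * 2 ^+ k.+1))//.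
      by rewrite truncn_le mulr_ge0// exprn_ge0.
    by rewrite natrX ler_piMl// exprn_ge0.
  have nFz : ~ F (cell z) y.
    move=> Fz; apply: nF; rewrite -(bigcup_mkord N F).
    by exists (cell z).
  have [j jK Bj] : exists2 j, (j <= K)%N & ball (c (cell z)) (2 * 2 ^- k.+2)
    (iter j f y).
    apply: contrapT => nex; apply: nFz; split=> // j jK Bj; apply: nex.
    by exists j.
  exists j => //.
  have half : 2 * 2 ^- k.+2 = 2 ^- k.+1 :> R by rewrite exprS invfM mulrA
    divff// mul1r.
  have cz' : `|c (cell z) - z| < 2 ^- k.+1.
    have [Xc _] := cP (cell z).
    have /andP[c0 _] := markov_unit markov_f Xc;
      have /andP[z0 _] := markov_unit markov_f Xz.
    have p0 : 0 < 2 ^+ k.+1 :> R by rewrite exprn_gt0.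
    rewrite -[ltRHS]mul1r ltr_pdivlMr// -{1}(gtr0_norm p0) -normrM mulrBl.
    have /andP[] := truncn_itv (mulr_ge0 c0 (ltW p0)).
    have /andP[] := truncn_itv (mulr_ge0 z0 (ltW p0)).
    rewrite -/(cell z) -/(cell (c (cell z))) cz -natr1 ltr_norml => ? ? ? ?;
      apply/andP; split; lra.
  have -> : iter j f y - z = (iter j f y - c (cell z)) + (c (cell z) - z) by
    ring.
  have -> : 2 ^- k = 2 ^- k.+1 + 2 ^- k.+1 :> R by rewrite exprS invfM; lra.
  apply: le_lt_trans (ler_normD _ _) _; rewrite ltrD//.
  by move: Bj; rewrite half /ball/= distrC.
Qed.

End symbolic_bounds.

Lemma cover_time_le : exponentially_psi_mixing P f mu ->
  (upper_minkowski_dim mu < +oo)%E ->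
  exists2 C : R, 0 < C & {ae mu, forall x, X x ->
    \forall r \near 0^'+, forall m, 0 < m -> M (8^-1 * r) = m%:E ->
      (cover_time X f r x <= (C * ln r ^+ 2 / m)%:E)%E}.
Proof.
move=> /psi_mixing_half[mut smut [q mix]] fin.
have supp0 : measure_support mu !=set0.
  have [y [_ [Xy _ _]]] := markov_two_points markov_f; exists y.
  exact: (support_repeller smut mix).
have [C0 C00 HC0] := cover_at_scale smut mix.
have /choice[m mP] : forall k, exists m : R, [/\ 0 < m, m <= 1 & M (2 ^- k.+2)
  = m%:E].
  by move=> k; apply: min_ball_measure_gt0; rewrite // invr_gt0 exprn_gt0.
have /choice[FK FKP] : forall k, exists FK : set (measurableTypeR R) * nat,
    [/\ measurable FK.1, (mu FK.1 <= (2 * k.+1%:R ^- 2)%:E)%E,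
        FK.2%:R <= C0 * k.+1%:R ^+ 2 / m k &
        forall x, X x -> ~ FK.1 x -> forall y, X y ->
          exists2 j, (j <= FK.2)%N & `|iter j f x - y| < 2 ^- k].
  by move=> k; have [m0 m1 Mm] := mP k; have [F [K FKP]] := HC0 k _ m0 m1 Mm;
    exists (F, K).
exists (36 * C0); first by rewrite mulr_gt0.
have : {ae mu, forall x, exists N, forall n, (N <= n)%N -> ~ (FK n).1 x}.
  apply: (@borel_cantelli_sqr _ (measurableTypeR R) R mu (fun n => (FK n).1) 2)
    => n;
  by case: (FKP n).
apply: aeS => x [N nF] Xx; apply/near0_rightP.
exists (2 ^- N.+1); first by rewrite invr_gt0 exprn_gt0.
move=> r /andP[r0 rN] m' m'0 Mr.
have [[//|k] Nk /andP[kr rk]] := dyadic_scale r0 (ltW rN).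
have tk := dyadic_ln r0 rk.
(* Here [2 ^- k.+2 < r <= 2 ^- k.+1]: covering at scale [k.+2] suffices, and its balls have radius
   [2 ^- k.+4 >= r / 8]. *)
have [m0 m1 Mm] := mP k.+2.
have {}nF : ~ (FK k.+2).1 x by apply: nF; exact: leq_trans (leqW Nk).
have [_ _ Kk cov] := FKP k.+2.
have mm : m' <= m k.+2.
  rewrite -lee_fin -Mm -Mr; apply: min_ball_measure_le.
  by move: rk; rewrite !exprS !invfM; set u := 2 ^- k; lra.
apply: (@le_trans _ _ (FK k.+2).2%:R%:E).
  apply: ereal_inf_lbound; exists (FK k.+2).2 => //= y Xy.
  have [j jK jy] := cov x Xx nF y Xy; exists j => //.
  by rewrite (lt_trans jy).
rewrite lee_fin (le_trans Kk)// -[leLHS]mulrA.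
(* From [k + 3 <= 3 (k + 1)] and [k + 1 <= 2 (- ln r)]. *)
have L : k.+3%:R ^+ 2 <= 36 * ln r ^+ 2.
  have -> : 36 * ln r ^+ 2 = (6 * - ln r) ^+ 2 by ring.
  have k1 : 1 <= k.+1%:R :> R by rewrite ler1n.
  have k3 : k.+3%:R = k.+1%:R + 2 :> R by rewrite -natrD addn2.
  by rewrite k3 lerXn2r// ?nnegrE; lra.
have -> : 36 * C0 * ln r ^+ 2 / m' = C0 * (36 * ln r ^+ 2 / m') by ring.
rewrite ler_pM2l//; apply: ler_pM => //; first by rewrite invr_ge0 ltW.
by rewrite lef_pV2.
Qed.

End upper_bounds.

(** * Cover exponents and Minkowski dimensions: the two estimates combined *)

Theorem theorem1p1 (R : realType) (A : pointedType) (P : A -> set R)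
    (X : set R) (f : R -> R) (mu : probability (measurableTypeR R) R)
    (countableA : countable [set: A])
    (markov_f : piecewise_expanding_markov P X f)
    (transitive_f : topologically_transitive P f)
    (supported : mu (repeller P X f) = 1%E)
    (invariant : invariant_measure X f mu)
    (ergodic : ergodic_measure X f mu)
    (finite_dim : (upper_minkowski_dim mu < +oo)%E) :
  {ae mu, forall x, repeller P X f x ->
    (upper_minkowski_dim mu <= upper_cover_exponent (repeller P X f) f x)%E /\
    (lower_minkowski_dim mu <= lower_cover_exponent (repeller P X f) f x)%E} /\
  (exponentially_psi_mixing P f mu ->
   {ae mu, forall x, repeller P X f x ->
     upper_cover_exponent (repeller P X f) f x = upper_minkowski_dim mu /\
     lower_cover_exponent (repeller P X f) f x = lower_minkowski_dim mu}).
Proof.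
rewrite (markov_repeller markov_f) in supported *.
have lower := minkowski_le_cover_exponent countableA markov_f supported invariant finite_dim.
split=> // mixing.
have [C C0 upper] := cover_time_le countableA markov_f mixing finite_dim.
have supp0 : measure_support mu !=set0.
  have [y [_ [Xy _ _]]] := markov_two_points markov_f; exists y.
  have [mut smut [q mix]] := psi_mixing_half countableA mixing.
  exact: (support_repeller countableA markov_f smut mix).
apply: aeS (aeI lower upper) => x [lx ux] Xx; have [lx1 lx2] := lx Xx.
have tau0 : \forall r \near (0 : R)^'+, (0 <= cover_time X f r x)%E.
  apply: nearW => r; apply: le_ereal_inf_tmp => _ [k _ <-].
  by rewrite lee_fin.
have c0 : 0 < 8^-1 :> R by rewrite invr_gt0.
have [ux1 ux2] := cover_exponent_le supp0 finite_dim C0 c0 tau0 (ux Xx).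
by split; apply/eqP; rewrite eq_le; [rewrite ux1 lx1|rewrite ux2 lx2].
Qed.
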